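(* Let $R$ be a commutative ring with unit, let $A$ be an $A_\infty$-algebra over $R$, and let $M$ and $N$ be $A_\infty$-bimodules over $A$. If $f=(f_{r,s})_{r,s\in\mathbb N_0}:M\to N$ is a morphism of $A_\infty$-bimodules over $A$ of degree $d\in\mathbb Z$, then the induced map $f_*:CH_*(A;M)\to CH_*(A;N)$ is a chain map of degree $-d$ (that is, $f_*$ is homogeneous of degree $-d$ and $b\circ f_*=f_*\circ b$, where $b$ denotes the respective Hochschild differentials).
   Context: Conventions: $\mathbb N=\{1,2,\dots\}$, $\mathbb N_0=\mathbb N\cup\{0\}$, $\otimes=\otimes_R$, graded modules are $\mathbb Z$-graded, empty sums are $0$. Formulas containing signs are stated for homogeneous elements and extended $R$-linearly. For $a\in A_j$ write $\mu(a)=j$ and $\|a\|=\mu(a)-1$ (reduced index). For $m\in M_j$ write $\mu(m)=\mu_M(m)=j$. For $a_1,\dots,a_n\in A$ put $\maltese_i^j=\sum_{q=i}^j\|a_q\|$ for $1\le i\le j\le n$ ($0$ if $j<i$). $A_\infty$-algebra: a graded $R$-module $A=\bigoplus_j A_j$ with graded $R$-module homomorphisms $\mu_n:A^{\otimes n}\to A$ of degree $2-n$ ($n\in\mathbb N$) such that for all $r\in\mathbb N$ and $a_1,\dots,a_r\in A$ $$\sum_{n_1,n_2\in\mathbb N,\ n_1+n_2=r+1}\ \sum_{i=1}^{r+1-n_1}(-1)^{\maltese_1^{i-1}}\mu_{n_2}(a_1,\dots,a_{i-1},\mu_{n_1}(a_i,\dots,a_{i+n_1-1}),a_{i+n_1},\dots,a_r)=0.$$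 $A_\infty$-bimodule over $A$: a graded $R$-module $M=\bigoplus_jM_j$ with $R$-module homomorphisms $\mu^M_{r,s}:A^{\otimes r}\otimes M\otimes A^{\otimes s}\to M$ of degree $1-r-s$ ($r,s\in\mathbb N_0$) such that for all $r,s\in\mathbb N_0$, $m\in M$, $a_1,\dots,a_{r+s}\in A$ (with $\maltese$ computed from the $a_q$ only): $$\sum_{r_1\in\mathbb N_0,r_2\in\mathbb N,\ r_1+r_2=r+1}\sum_{i=1}^{r_1}(-1)^{\maltese_1^{i-1}}\mu^M_{r_1,s}(a_1,\dots,\mu_{r_2}(a_i,\dots,a_{i+r_2-1}),\dots,a_r,m,a_{r+1},\dots,a_{r+s})$$ $$+\sum_{r_1+r_2=r}\ \sum_{s_1+s_2=s}(-1)^{\maltese_1^{r_1}}\mu^M_{r_1,s_1}(a_1,\dots,a_{r_1},\mu^M_{r_2,s_2}(a_{r_1+1},\dots,a_r,m,a_{r+1},\dots,a_{r+s_2}),a_{r+s_2+1},\dots,a_{r+s})$$ $$+\sum_{s_1\in\mathbb N_0,s_2\in\mathbb N,\ s_1+s_2=s+1}\sum_{j=1}^{s_1}(-1)^{\maltese_1^{r+j-1}+\mu_M(m)}\mu^M_{r,s_1}(a_1,\dots,a_r,m,a_{r+1},\dots,a_{r+j-1},\mu_{s_2}(a_{r+j},\dots,a_{r+j+s_2-1}),\dots,a_{r+s})=0,$$ where in the second line $r_1,r_2,s_1,s_2\in\mathbb N_0$. Morphism of $A_\infty$-bimodules $f:M\to N$ of degree $d$: a family of $R$-module homomorphisms $f_{r,s}:A^{\otimes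 r}\otimes M\otimes A^{\otimes s}\to N$ of degree $d-r-s$ ($r,s\in\mathbb N_0$) such that for all $r,s$, $m\in M$, $a_1,\dots,a_{r+s}\in A$: $$\sum_{r_1+r_2=r}\sum_{s_1+s_2=s}(-1)^{d\cdot\maltese_1^{r_1}}\mu^N_{r_1,s_1}(a_1,\dots,a_{r_1},f_{r_2,s_2}(a_{r_1+1},\dots,a_r,m,a_{r+1},\dots,a_{r+s_2}),a_{r+s_2+1},\dots,a_{r+s})$$ $$=\sum_{r_1,r_2\in\mathbb N,\ r_1+r_2=r+1}\sum_{i=1}^{r_1}(-1)^{\maltese_1^{i-1}+d}f_{r_1,s}(a_1,\dots,a_{i-1},\mu_{r_2}(a_i,\dots,a_{i+r_2-1}),a_{i+r_2},\dots,a_r,m,a_{r+1},\dots,a_{r+s})$$ $$+\sum_{r_1+r_2=r}\sum_{s_1+s_2=s}(-1)^{\maltese_1^{r_1}+d}f_{r_1,s_1}(a_1,\dots,a_{r_1},\mu^M_{r_2,s_2}(a_{r_1+1},\dots,a_r,m,a_{r+1},\dots,a_{r+s_2}),a_{r+s_2+1},\dots,a_{r+s})$$ $$+\sum_{s_1,s_2\in\mathbb N,\ s_1+s_2=s+1}\sum_{i=1}^{s_1}(-1)^{\maltese_1^{r+i-1}+\mu(m)+d}f_{r,s_1}(a_1,\dots,a_r,m,a_{r+1},\dots,a_{r+i-1},\mu_{s_2}(a_{r+i},\dots,a_{r+i+s_2-1}),\dots,a_{r+s}),$$ where in the sums over $r_1+r_2=r$, $s_1+s_2=s$ all indices lie in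 $\mathbb N_0$. Hochschild chains: $CH_*(A;M)=\bigoplus_{n\ge0}M\otimes A^{\otimes n}$, graded by $\deg(m\otimes a_1\otimes\dots\otimes a_n)=n-\mu(m)-\sum_{q=1}^n\mu(a_q)=-\mu(m)-\sum_{q=1}^n\|a_q\|$. For $m\otimes a_1\otimes\dots\otimes a_n$ put $\maltese_0^i=\mu(m)+\maltese_1^i$ and $*_{i}=\maltese_0^{i}\cdot\maltese_{i+1}^n$. The Hochschild differential (which lowers degree by one and squares to zero) is $$b(m\otimes a_1\otimes\dots\otimes a_n)=\sum_{l=1}^{n+1}\Big(\mu^M_{0,l-1}(m,a_1,\dots,a_{l-1})\otimes a_l\otimes\dots\otimes a_n$$ $$+\sum_{i=1}^{n-l+1}(-1)^{\maltese_0^{i-1}}m\otimes a_1\otimes\dots\otimes a_{i-1}\otimes\mu_l(a_i,\dots,a_{i+l-1})\otimes a_{i+l}\otimes\dots\otimes a_n$$ $$+\sum_{i=n-l+2}^{n}[i\ge1](-1)^{*_{i-1}}\mu^M_{n-i+1,\,i+l-n-2}(a_i,\dots,a_n,m,a_1,\dots,a_{i+l-n-2})\otimes a_{i+l-n-1}\otimes\dots\otimes a_{i-1}\Big),$$ where $[i\ge1]$ restricts the sum to $i\ge1$. Induced map: for $r,s\in\mathbb N_0$ let $\bar f_{r,s}:CH_*(A;M)\to CH_*(A;N)$ be given on $m\otimes a_1\otimes\dots\otimes a_n$ by $f_{r,s}(a_{n-r+1},\dots,a_n,m,a_1,\dots,a_s)\otimes a_{s+1}\otimes\dots\otimes a_{n-r}$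 if $r+s\le n$, and by $0$ if $r+s>n$. Then $$f_*(m\otimes a_1\otimes\dots\otimes a_n)=\sum_{r,s\in\mathbb N_0}(-1)^{\dag_r}\,\bar f_{r,s}(m\otimes a_1\otimes\dots\otimes a_n),\qquad \dag_r=*_{n-r}+d\cdot\deg(m\otimes a_1\otimes\dots\otimes a_n).$$ *)

(* Defs.v *)
From HB Require Import structures.
From mathcomp Require Import all_boot all_order all_algebra.
From mathcomp Require Import boolp zify.

Set Implicit Arguments.
Unset Strict Implicit.
Unset Printing Implicit Defensive.

Import GRing.Theory.
Local Open Scope ring_scope.

Lemma lin0 (R : pzRingType) (U V : lmodType R) (f : U -> V) :
  linear f -> f 0 = 0.
Proof.
by move=> fL; have := fL (-1) 0 0; rewrite scaler0 addr0 scaleN1r addNr.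
Qed.

Lemma lin_sum (R : pzRingType) (U V : lmodType R) (I : Type) (s : seq I)
    (f : I -> U -> V) :
  (forall i, linear (f i)) -> linear (fun x => \sum_(i <- s) f i x).
Proof.
move=> fL c x y; rewrite scaler_sumr -big_split; apply: eq_bigr => i _.
exact: fL.
Qed.

Section DirectSum.
Variables (R : pzRingType) (I : choiceType) (V : I -> lmodType R).

Definition finsupp_family (f : forall i, V i) : Prop :=
  exists s : seq I, forall i, i \notin s -> f i = 0.

Record dsum := DSum {
  dscoord :> forall i, V i;
  dscoordP : finsupp_family dscoord }.

HB.instance Definition _ := gen_eqMixin dsum.
HB.instance Definition _ := gen_choiceMixin dsum.

Lemma dsumP (x y : dsum) : (forall i, x i = y i) -> x = y.
Proof.
case: x y => [f fP] [g gP] /= fg.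
have E : f = g by apply: functional_extensionality_dep.
by case: g / E gP {fg} => gP; congr DSum; apply: Prop_irrelevance.
Qed.

Fact ds0_subproof : finsupp_family (fun i => 0 : V i).
Proof. by exists [::]. Qed.
Definition ds0 := DSum ds0_subproof.

Fact dsN_subproof (x : dsum) : finsupp_family (fun i => - x i).
Proof. by case: x => f [s sP]; exists s => i /sP /= ->; rewrite oppr0. Qed.
Definition dsN x := DSum (dsN_subproof x).

Fact dsD_subproof (x y : dsum) : finsupp_family (fun i => x i + y i).
Proof.
case: x y => f [s sP] [g [t tP]]; exists (s ++ t) => i /=.
by rewrite mem_cat negb_or => /andP[/sP -> /tP ->]; rewrite addr0.
Qed.
Definition dsD x y := DSum (dsD_subproof x y).

Fact dsZ_subproof (c : R) (x : dsum) : finsupp_family (fun i => c *: x i).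
Proof. by case: x => f [s sP]; exists s => i /sP /= ->; rewrite scaler0. Qed.
Definition dsZ c x := DSum (dsZ_subproof c x).

Fact dsDA : associative dsD.
Proof. by move=> x y z; apply: dsumP => i /=; rewrite addrA. Qed.
Fact dsDC : commutative dsD.
Proof. by move=> x y; apply: dsumP => i /=; rewrite addrC. Qed.
Fact ds0D : left_id ds0 dsD.
Proof. by move=> x; apply: dsumP => i /=; rewrite add0r. Qed.
Fact dsND : left_inverse ds0 dsN dsD.
Proof. by move=> x; apply: dsumP => i /=; rewrite addNr. Qed.
HB.instance Definition _ := GRing.isZmodule.Build dsum dsDA dsDC ds0D dsND.

Fact dsZA a b x : dsZ a (dsZ b x) = dsZ (a * b) x.
Proof. by apply: dsumP => i /=; rewrite scalerA. Qed.
Fact ds1Z : left_id 1 dsZ.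
Proof. by move=> x; apply: dsumP => i /=; rewrite scale1r. Qed.
Fact dsZDr : right_distributive dsZ +%R.
Proof. by move=> a x y; apply: dsumP => i /=; rewrite scalerDr. Qed.
Fact dsZDl x : {morph dsZ^~ x : a b / a + b}.
Proof. by move=> a b; apply: dsumP => i /=; rewrite scalerDl. Qed.
HB.instance Definition _ :=
  GRing.Zmodule_isLmodule.Build R dsum dsZA ds1Z dsZDr dsZDl.

Fact dsinj_subproof i (v : V i) :
  finsupp_family (dfwith (T := V) (fun j => 0 : V j) v).
Proof.
by exists [:: i] => j; rewrite inE eq_sym => ji; rewrite dfwith_out.
Qed.
Definition dsinj i (v : V i) : dsum := DSum (dsinj_subproof v).
Arguments dsinj : clear implicits.

Lemma dsinjE i (v : V i) : dsinj i v i = v.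
Proof. exact: dfwith_in. Qed.
Lemma dsinj_out i (v : V i) j : i != j -> dsinj i v j = 0.
Proof. exact: dfwith_out. Qed.

Lemma dscoord_linear i : linear (fun x : dsum => x i).
Proof. by []. Qed.

Lemma dsinj_linear i : linear (dsinj i).
Proof.
move=> c u v; apply: dsumP => j.
rewrite (dscoord_linear j) /=.
by case: dfwithP => [|k ik]; rewrite ?dfwith_in // !dfwith_out // scaler0 addr0.
Qed.
HB.instance Definition _ i :=
  GRing.isLinear.Build R (V i) dsum _ (dsinj i) (@dsinj_linear i).

Lemma dscoord_sum (J : Type) (s : seq J) (F : J -> dsum) i :
  (\sum_(j <- s) F j) i = \sum_(j <- s) F j i.
Proof. by elim/big_ind2: _ => // x1 x2 y1 y2 <- <-. Qed.

Lemma dsum_decomp (x : dsum) (s : seq I) : uniq s ->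
  (forall i, i \notin s -> x i = 0) -> x = \sum_(i <- s) dsinj i (x i).
Proof.
move=> us xs; apply: dsumP => i; rewrite dscoord_sum.
have [is_|/[dup] ns /xs ->] := boolP (i \in s); last first.
  rewrite big_seq big1 // => j js; rewrite dsinj_out //.
  by apply: contraNneq ns => <-.
rewrite (bigD1_seq i) //= dfwith_in big1 ?addr0 // => j ji.
by rewrite -[LHS]/(dsinj j (x j) i) dsinj_out.
Qed.

Lemma dsum_finsupp (x : dsum) :
  exists2 s : seq I, uniq s & forall i, i \notin s -> x i = 0.
Proof.
case: x => f [s fs]; exists (undup s); first exact: undup_uniq.
by move=> i; rewrite mem_undup => /fs.
Qed.

Lemma dsum_ind (P : dsum -> Prop) : P 0 ->
  (forall i (v : V i) x, P x -> P (dsinj i v + x)) -> forall x, P x.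
Proof.
move=> P0 PD x; have [s us xs] := dsum_finsupp x.
rewrite (dsum_decomp us xs); elim: s {us xs} => [|i s IHs]; first by rewrite big_nil.
by rewrite big_cons; apply: PD.
Qed.

Lemma dsum_lift (W : lmodType R) (g : forall i, V i -> W) :
  (forall i, linear (g i)) ->
  exists2 h : dsum -> W, linear h & forall i (v : V i), h (dsinj i v) = g i v.
Proof.
move=> gL.
have g0 i : g i 0 = 0 by apply: lin0.
pose supp x := sval (cid2 (dsum_finsupp x)).
have suppU x : uniq (supp x) by rewrite /supp; case: cid2.
have suppP x i : i \notin supp x -> x i = 0 by rewrite /supp; case: cid2 => ? /= _; apply.
pose h x := \sum_(i <- supp x) g i (x i).
have subE (x : dsum) s t : uniq s -> uniq t -> {subset s <= t} ->
    (forall i, i \notin s -> x i = 0) ->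
    \sum_(i <- s) g i (x i) = \sum_(i <- t) g i (x i).
  move=> us ut st xs; rewrite [RHS](bigID (mem s)) /= [X in _ + X]big1 => [|i].
    rewrite addr0 -[RHS]big_filter; apply: perm_big; apply: uniq_perm => //.
      by rewrite filter_uniq.
    move=> i; rewrite mem_filter /=.
    by case: (boolP (i \in s)) => //= /st ->.
  by move=> /xs ->.
have hE (x : dsum) s : uniq s -> (forall i, i \notin s -> x i = 0) ->
    h x = \sum_(i <- s) g i (x i).
  move=> us xs; rewrite /h (subE x (supp x) (undup (supp x ++ s))) //.
  - rewrite (subE x s (undup (supp x ++ s))) ?undup_uniq //.
    by move=> i; rewrite mem_undup mem_cat => ->; rewrite orbT.
  - exact: undup_uniq.
  - by move=> i; rewrite mem_undup mem_cat => ->.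
  - exact: suppP.
exists h => [c x y|i v]; last first.
  rewrite (hE _ [:: i]) // ?big_seq1 ?dsinjE // => j.
  by rewrite inE eq_sym => ij; rewrite dsinj_out.
pose s := undup (supp x ++ supp y).
have us : uniq s by apply: undup_uniq.
have xs i : i \notin s -> x i = 0.
  by rewrite mem_undup mem_cat negb_or => /andP[/suppP].
have ys i : i \notin s -> y i = 0.
  by rewrite mem_undup mem_cat negb_or => /andP[_ /suppP].
rewrite (hE x s) // (hE y s) // (hE _ s) //; last first.
  by move=> i is_; rewrite (dscoord_linear i) xs // ys // scaler0 addr0.
rewrite scaler_sumr -big_split /=; apply: eq_bigr => i _.
exact: gL.
Qed.

End DirectSum.
Arguments dsinj {R I V} i v.

Section Quotient.
Variables (R : pzRingType) (V : lmodType R).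

Definition lspan (S : V -> Prop) : {pred V} := fun x =>
  `[< forall P : {pred V}, submod_closed P -> (forall y, S y -> y \in P) ->
      x \in P >].

Lemma lspanP S x : reflect (forall P : {pred V}, submod_closed P ->
  (forall y, S y -> y \in P) -> x \in P) (x \in lspan S).
Proof. exact: asboolP. Qed.

Lemma lspan_submod S : submod_closed (lspan S).
Proof.
split; first by apply/lspanP => P [].
move=> c x y /lspanP xS /lspanP yS; apply/lspanP => P PP PS.
by apply: (PP.2); [apply: xS|apply: yS].
Qed.

Lemma lspan_sub (S : V -> Prop) x : S x -> x \in lspan S.
Proof. by move=> Sx; apply/lspanP => P _; apply. Qed.

Variable S : V -> Prop.

Lemma lspan0 : 0 \in lspan S.
Proof. exact: (lspan_submod S).1. Qed.
Lemma lspanZD c x y : x \in lspan S -> y \in lspan S -> c *: x + y \in lspan S.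
Proof. by move=> xS yS; apply: (lspan_submod S).2. Qed.
Lemma lspanD x y : x \in lspan S -> y \in lspan S -> x + y \in lspan S.
Proof. by move=> xS yS; rewrite -[x]scale1r lspanZD. Qed.
Lemma lspanZ c x : x \in lspan S -> c *: x \in lspan S.
Proof. by move=> xS; rewrite -[_ *: _]addr0 lspanZD ?lspan0. Qed.
Lemma lspanN x : x \in lspan S -> - x \in lspan S.
Proof. by move=> xS; rewrite -scaleN1r lspanZ. Qed.

Definition lquot_rel : rel V := fun x y => x - y \in lspan S.
Fact lquot_equiv : equiv_class_of lquot_rel.
Proof.
split=> [x|x y|y x z]; rewrite /lquot_rel.
- by rewrite subrr lspan0.
- by apply/idP/idP => /lspanN; rewrite opprB.
- by move=> xy yz; rewrite -[x](subrK y) -addrA lspanD.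
Qed.
Canonical lquot_equivRel := EquivRelPack lquot_equiv.

Definition lquot := {eq_quot lquot_rel}%qT.
HB.instance Definition _ := Choice.on lquot.

Definition lpi (x : V) : lquot := (\pi_({eq_quot lquot_rel}%qT) x)%qT.
Definition lrepr (q : lquot) : V := (repr q)%qT.

Lemma lreprK : cancel lrepr lpi.
Proof. by move=> q; rewrite /lpi /lrepr reprK. Qed.
Lemma lpiE x y : (lpi x = lpi y) <-> (x - y \in lspan S).
Proof. by split=> [/eqmodP|h]; [|apply/eqmodP]. Qed.

Definition lq0 := lpi 0.
Definition lqN q := lpi (- lrepr q).
Definition lqD q r := lpi (lrepr q + lrepr r).
Definition lqZ c q := lpi (c *: lrepr q).

Lemma lpi_repr x : lrepr (lpi x) - x \in lspan S.
Proof. by apply/lpiE; rewrite lreprK. Qed.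
Lemma lqNE x : lqN (lpi x) = lpi (- x).
Proof. by apply/lpiE; rewrite -opprD lspanN// lpi_repr. Qed.
Lemma lqDE x y : lqD (lpi x) (lpi y) = lpi (x + y).
Proof. by apply/lpiE; rewrite opprD addrACA lspanD// lpi_repr. Qed.
Lemma lqZE c x : lqZ c (lpi x) = lpi (c *: x).
Proof. by apply/lpiE; rewrite -scalerBr lspanZ// lpi_repr. Qed.

Fact lqDA : associative lqD.
Proof.
move=> x y z; rewrite -[x]lreprK -[y]lreprK -[z]lreprK !lqDE.
by rewrite addrA.
Qed.
Fact lqDC : commutative lqD.
Proof. by move=> x y; rewrite /lqD addrC. Qed.
Fact lq0D : left_id lq0 lqD.
Proof. by move=> x; rewrite -[x]lreprK lqDE add0r. Qed.
Fact lqND : left_inverse lq0 lqN lqD.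
Proof. by move=> x; rewrite -[x]lreprK lqNE lqDE addNr. Qed.
HB.instance Definition _ := GRing.isZmodule.Build lquot lqDA lqDC lq0D lqND.

Fact lqZA a b x : lqZ a (lqZ b x) = lqZ (a * b) x.
Proof. by rewrite -[x]lreprK !lqZE scalerA. Qed.
Fact lq1Z : left_id 1 lqZ.
Proof. by move=> x; rewrite -[x]lreprK lqZE scale1r. Qed.
Fact lqZDr : right_distributive lqZ +%R.
Proof.
move=> a x y; rewrite -[x]lreprK -[y]lreprK.
by rewrite /GRing.add /= lqDE !lqZE lqDE scalerDr.
Qed.
Fact lqZDl x : {morph lqZ^~ x : a b / a + b}.
Proof.
move=> a b; rewrite -[x]lreprK /= !lqZE.
by rewrite {2}/GRing.add /= lqDE scalerDl.
Qed.
HB.instance Definition _ :=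
  GRing.Zmodule_isLmodule.Build R lquot lqZA lq1Z lqZDr lqZDl.

Fact lpi_linear : linear lpi.
Proof.
move=> c x y; apply/esym.
by rewrite /GRing.add /GRing.scale /= lqZE lqDE.
Qed.
HB.instance Definition _ := GRing.isLinear.Build R V lquot _ lpi lpi_linear.

Lemma lquot_lift (W : lmodType R) (g : V -> W) : linear g ->
  (forall x, S x -> g x = 0) ->
  exists2 h : lquot -> W, linear h & forall x, h (lpi x) = g x.
Proof.
move=> gL gS.
have gspan x : x \in lspan S -> g x = 0.
  move=> /lspanP xS; apply/eqP; apply: (xS (fun x => g x == 0)).
    split; first by rewrite unfold_in -(subrr 0) -scaleN1r addrC gL scaleN1r addNr.
    by move=> c u v /eqP gu /eqP gv; rewrite unfold_in gL gu gv scaler0 addr0.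
  by move=> y /gS gy; rewrite unfold_in gy.
have gB x y : x - y \in lspan S -> g x = g y.
  move=> /gspan; rewrite addrC -scaleN1r gL scaleN1r => /eqP.
  by rewrite addrC subr_eq0 => /eqP.
exists (g \o lrepr) => [c x y|x] /=; last exact/gB/lpi_repr.
rewrite -gL; apply: gB.
by rewrite -[X in lrepr (_ *: X + _)]lreprK -[X in lrepr (_ + X)]lreprK
   -linearP lpi_repr.
Qed.

End Quotient.

Section Tensor.
Variables (R : comPzRingType) (U V : lmodType R).

Definition free_module : lmodType R :=
  dsum (fun _ : (U * V)%type => R^o : lmodType R).
Definition free_gen (u : U) (v : V) : free_module :=
  @dsinj _ _ (fun _ : (U * V)%type => R^o : lmodType R) (u, v) 1.

Inductive bilinear_relation : free_module -> Prop :=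
| BilinearL c u u' v : bilinear_relation
    (free_gen (c *: u + u') v - (c *: free_gen u v + free_gen u' v))
| BilinearR c u v v' : bilinear_relation
    (free_gen u (c *: v + v') - (c *: free_gen u v + free_gen u v')).

Definition tensor : lmodType R := lquot bilinear_relation.
Definition tens (u : U) (v : V) : tensor := lpi bilinear_relation (free_gen u v).

Lemma tens_linearl v : linear (tens^~ v).
Proof.
move=> c u u'; rewrite /tens -linearP; apply/lpiE/lspan_sub.
exact: BilinearL.
Qed.

Lemma tens_linearr u : linear (tens u).
Proof.
move=> c v v'; rewrite /tens -linearP; apply/lpiE/lspan_sub.
exact: BilinearR.
Qed.

Lemma tensor_ind (P : tensor -> Prop) : P 0 ->
  (forall u v x, P x -> P (tens u v + x)) -> forall x, P x.
Proof.
move=> P0 PD x; rewrite -[x]lreprK; elim/dsum_ind: (lrepr x) => [|[u v] r y Py].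
  by rewrite linear0.
rewrite linearD; have := PD (r *: u) v _ Py; congr (P (_ + _)).
have -> : dsinj (u, v) r = r *: free_gen u v.
  by rewrite /free_gen -linearZ /= [r *: _]mulr1.
rewrite linearZ -/(tens u v).
by have := tens_linearl v r u 0; rewrite /= (lin0 (tens_linearl v)) !addr0.
Qed.

Lemma tensor_lift (W : lmodType R) (g : U -> V -> W) :
  (forall v, linear (g^~ v)) -> (forall u, linear (g u)) ->
  exists2 h : tensor -> W, linear h & forall u v, h (tens u v) = g u v.
Proof.
move=> gl gr.
have [|k kL kE] := @dsum_lift R _ (fun _ : (U * V)%type => R^o : lmodType R) W
  (fun p r => r *: g p.1 p.2).
  move=> p c r r'; have := scalerDl (g p.1 p.2) (c * r) r'.
  by rewrite -scalerA; apply.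
have kg u v : k (free_gen u v) = g u v by rewrite kE scale1r.
have [|h hL hE] := @lquot_lift R _ bilinear_relation W k kL.
  move=> x; case=> [c u u' v|c u v v'];
    rewrite addrC -scaleN1r !kL !kg ?(gl v c u u') ?(gr u c v v') scaleN1r addNr //.
by exists h => // u v; rewrite hE kg.
Qed.

End Tensor.

Section TensorPower.
Variables (R : comPzRingType) (A : lmodType R).

Fixpoint tpow (n : nat) : lmodType R :=
  if n is n'.+1 then tensor A (tpow n') else R^o.

(* a_1 (x) ... (x) a_n, for a sequence s = [:: a_1; ...; a_n] of size n. *)
Fixpoint tpure (n : nat) (s : seq A) : tpow n :=
  if n is n'.+1 return tpow n then tens (head 0 s) (tpure n' (behead s)) else 1.

End TensorPower.

(* An explicit Z-graded module: the family of its homogeneous components. *)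
Definition gmod (R : comPzRingType) := int -> lmodType R.

Section GradedModule.
Variables (R : comPzRingType) (V : gmod R).

Definition gtotal : lmodType R := dsum V.

(* A homogeneous element together with a choice of its degree, so that the
   degree is also meaningful for 0. *)
Definition hel := {j : int & V j}.
Definition mkhel (j : int) (x : V j) : hel := Tagged V x.
Definition deg (h : hel) : int := tag h.
Definition hval (h : hel) : gtotal := dsinj (tag h) (tagged h).

Definition homogeneous (j : int) (x : gtotal) : Prop :=
  exists v : V j, x = dsinj j v.

End GradedModule.

Definition sgn (R : comPzRingType) (k : int) : R := (-1) ^+ `|k|%N.

(* [:: a_i; ...; a_j] for a = [:: a_1; ...; a_n], with indices starting at 1;
   empty if j < i. *)
Definition slice (T : Type) (i j : nat) (a : seq T) : seq T :=
  drop i.-1 (take j a).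

Section Sequences.
Variables (R : comPzRingType) (V : gmod R).
Implicit Type a : seq (hel V).

Definition vals a : seq (gtotal V) := map (@hval R V) a.
Definition seg (i j : nat) a : seq (gtotal V) := vals (slice i j a).
Definition maltese (i j : nat) a : int := \sum_(h <- slice i j a) (deg h - 1).

End Sequences.

Section AInfinityAlgebra.
Variable R : comPzRingType.

(* mu n is the operation with n.+1 inputs, so that there is no mu_0. *)
Definition ainf_ops (V : gmod R) :=
  forall n : nat, {linear tpow (gtotal V) n.+1 -> gtotal V}.

Definition app_ops (V : gmod R) (mu : ainf_ops V) (s : seq (gtotal V)) : gtotal V :=
  mu (size s).-1 (tpure (size s).-1.+1 s).

Definition ainf_degree (V : gmod R) (mu : ainf_ops V) : Prop :=
  forall a : seq (hel V), (0 < size a)%N ->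
    homogeneous (\sum_(h <- a) deg h + 2 - (size a)%:Z) (app_ops mu (vals a)).

Definition ainf_relation (V : gmod R) (mu : ainf_ops V) : Prop :=
  forall (r : nat) (a : seq (hel V)), (0 < r)%N -> size a = r ->
  \sum_(1 <= n1 < r.+1) \sum_(1 <= i < r.+2 - n1)
     sgn R (maltese 1 (i - 1) a) *:
       app_ops mu (seg 1 (i - 1) a ++
                   app_ops mu (seg i (i + n1 - 1) a) :: seg (i + n1) r a) = 0.

Record ainf_algebra := AInfAlgebra {
  alg_mod : gmod R;
  alg_ops : ainf_ops alg_mod;
  alg_degree : ainf_degree alg_ops;
  alg_relation : ainf_relation alg_ops }.

End AInfinityAlgebra.

Section AInfinityBimodule.
Variables (R : comPzRingType) (A : ainf_algebra R).
Local Notation tA := (gtotal (alg_mod A)).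
Local Notation hA := (hel (alg_mod A)).

Definition mu (s : seq tA) : tA := app_ops (alg_ops A) s.

Definition bimod_ops (M N : gmod R) :=
  forall r s : nat,
    {linear tensor (tpow tA r) (tensor (gtotal M) (tpow tA s)) -> gtotal N}.

Definition app_bimod_ops (M N : gmod R) (f : bimod_ops M N)
    (s : seq tA) (x : gtotal M) (t : seq tA) : gtotal N :=
  f (size s) (size t)
    (tens (tpure (size s) s) (tens x (tpure (size t) t))).

(* The component with r + s algebra inputs has degree k - r - s. *)
Definition bimod_ops_degree (M N : gmod R) (k : int) (f : bimod_ops M N) : Prop :=
  forall (a : seq hA) (m : hel M) (a' : seq hA),
    homogeneous (\sum_(h <- a) deg h + deg m + \sum_(h <- a') deg h
                 + (k - (size a)%:Z - (size a')%:Z))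
      (app_bimod_ops f (vals a) (hval m) (vals a')).

Definition bimod_relation (M : gmod R) (muM : bimod_ops M M) : Prop :=
  let muM := app_bimod_ops muM in
  forall (r s : nat) (m : hel M) (a : seq hA), size a = (r + s)%N ->
  \sum_(1 <= r2 < r.+2) \sum_(1 <= i < r.+2 - r2)
     sgn R (maltese 1 (i - 1) a) *:
       muM (seg 1 (i - 1) a ++ mu (seg i (i + r2 - 1) a) :: seg (i + r2) r a)
           (hval m) (seg r.+1 (r + s) a)
  + \sum_(0 <= r1 < r.+1) \sum_(0 <= s2 < s.+1)
     sgn R (maltese 1 r1 a) *:
       muM (seg 1 r1 a)
           (muM (seg r1.+1 r a) (hval m) (seg r.+1 (r + s2) a))
           (seg (r + s2).+1 (r + s) a)
  + \sum_(1 <= s2 < s.+2) \sum_(1 <= j < s.+2 - s2)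
     sgn R (maltese 1 (r + j - 1) a + deg m) *:
       muM (seg 1 r a) (hval m)
           (seg r.+1 (r + j - 1) a ++
            mu (seg (r + j) (r + j + s2 - 1) a) :: seg (r + j + s2) (r + s) a)
  = 0.

Record ainf_bimodule := AInfBimodule {
  bimod_mod : gmod R;
  bimod_op : bimod_ops bimod_mod bimod_mod;
  bimod_degree : bimod_ops_degree 1 bimod_op;
  bimod_rel : bimod_relation bimod_op }.

Definition muB (M : ainf_bimodule) := app_bimod_ops (@bimod_op M).

Definition bimod_morphism_relation (M N : ainf_bimodule) (d : int)
    (f : bimod_ops (bimod_mod M) (bimod_mod N)) : Prop :=
  let f := app_bimod_ops f in
  forall (r s : nat) (m : hel (bimod_mod M)) (a : seq hA), size a = (r + s)%N ->
  \sum_(0 <= r1 < r.+1) \sum_(0 <= s2 < s.+1)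
     sgn R (d * maltese 1 r1 a) *:
       muB (seg 1 r1 a)
           (f (seg r1.+1 r a) (hval m) (seg r.+1 (r + s2) a))
           (seg (r + s2).+1 (r + s) a)
  =
  \sum_(1 <= r2 < r.+1) \sum_(1 <= i < r.+2 - r2)
     sgn R (maltese 1 (i - 1) a + d) *:
       f (seg 1 (i - 1) a ++ mu (seg i (i + r2 - 1) a) :: seg (i + r2) r a)
         (hval m) (seg r.+1 (r + s) a)
  + \sum_(0 <= r1 < r.+1) \sum_(0 <= s2 < s.+1)
     sgn R (maltese 1 r1 a + d) *:
       f (seg 1 r1 a)
         (muB (seg r1.+1 r a) (hval m) (seg r.+1 (r + s2) a))
         (seg (r + s2).+1 (r + s) a)
  + \sum_(1 <= s2 < s.+1) \sum_(1 <= i < s.+2 - s2)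
     sgn R (maltese 1 (r + i - 1) a + deg m + d) *:
       f (seg 1 r a) (hval m)
         (seg r.+1 (r + i - 1) a ++
          mu (seg (r + i) (r + i + s2 - 1) a) :: seg (r + i + s2) (r + s) a).

Record bimod_morphism (M N : ainf_bimodule) (d : int) := BimodMorphism {
  mor_op : bimod_ops (bimod_mod M) (bimod_mod N);
  mor_degree : bimod_ops_degree d mor_op;
  mor_rel : bimod_morphism_relation d mor_op }.

Definition mor (M N : ainf_bimodule) (d : int) (f : bimod_morphism M N d) :=
  app_bimod_ops (mor_op f).

End AInfinityBimodule.

Section HochschildChains.
Variables (R : comPzRingType) (A : ainf_algebra R).
Local Notation tA := (gtotal (alg_mod A)).
Local Notation hA := (hel (alg_mod A)).

Section Chains.
Variable M : ainf_bimodule A.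
Local Notation tM := (gtotal (bimod_mod M)).
Local Notation hM := (hel (bimod_mod M)).

Definition CH : lmodType R := dsum (fun n : nat => tensor tM (tpow tA n)).

(* m (x) a_1 (x) ... (x) a_n *)
Definition chain (x : tM) (s : seq tA) : CH :=
  dsinj (V := fun n : nat => tensor tM (tpow tA n)) (size s)
    (tens x (tpure (size s) s)).

Definition chain_deg (m : hM) (a : seq hA) : int :=
  (size a)%:Z - deg m - \sum_(h <- a) deg h.

Definition CH_deg (k : int) : {pred CH} :=
  lspan (fun x => exists (m : hM) (a : seq hA),
           chain_deg m a = k /\ x = chain (hval m) (vals a)).

Definition maltese0 (m : hM) (i : nat) (a : seq hA) : int :=
  deg m + maltese 1 i a.

Definition star (m : hM) (i : nat) (a : seq hA) : int :=
  maltese0 m i a * maltese i.+1 (size a) a.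

(* F is R-multilinear on homogeneous elements of any fixed degrees. *)
Definition hmultilinear (W : lmodType R) (F : hM -> seq hA -> W) : Prop :=
  (forall a j c (x y : bimod_mod M j),
     F (mkhel (c *: x + y)) a = c *: F (mkhel x) a + F (mkhel y) a) /\
  (forall m a1 a2 j c (x y : alg_mod A j),
     F m (a1 ++ mkhel (c *: x + y) :: a2) =
     c *: F m (a1 ++ mkhel x :: a2) + F m (a1 ++ mkhel y :: a2)).

End Chains.
End HochschildChains.

Arguments CH {R A} M.
Arguments CH_deg {R A} M k.

Section Lifting.
Variable R : comPzRingType.

Lemma lin_comp (U V W : lmodType R) (f : V -> W) (g : U -> V) :
  linear f -> linear g -> linear (fun x => f (g x)).
Proof. by move=> fL gL c x y; rewrite gL fL. Qed.

Lemma lin_comb (U V : lmodType R) (c : R) (f g : U -> V) :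
  linear f -> linear g -> linear (fun x => c *: f x + g x).
Proof.
move=> fL gL k x y; rewrite fL gL !scalerDr !scalerA (mulrC c k).
by rewrite -!addrA; congr (_ + _); rewrite addrCA.
Qed.

Lemma linD (U V : lmodType R) (f : U -> V) : linear f ->
  forall x y, f (x + y) = f x + f y.
Proof. by move=> fL x y; have := fL 1 x y; rewrite !scale1r. Qed.

Section Graded.
Variable V : gmod R.
Implicit Types (W : lmodType R) (a : seq (hel V)).

Lemma gtensor_ext (T W : lmodType R) (g g' : tensor (gtotal V) T -> W) :
  linear g -> linear g' ->
  (forall h t, g (tens (hval h) t) = g' (tens (hval h) t)) -> g =1 g'.
Proof.
move=> gL gL' gg' x; elim/tensor_ind: x => [|u t x IHx]; first by rewrite !lin0.
rewrite (linD gL) (linD gL') IHx; congr (_ + _).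
have tL := @tens_linearl R (gtotal V) T t.
elim/dsum_ind: u => [|j v u IHu]; first by rewrite (lin0 tL) !lin0.
rewrite (linD tL) (linD gL) (linD gL') IHu; congr (_ + _).
exact: (gg' (mkhel v)).
Qed.

Lemma gtensor_lift (T W : lmodType R) (F : hel V -> T -> W) :
  (forall h, linear (F h)) ->
  (forall j t, linear (fun v : V j => F (mkhel v) t)) ->
  exists2 g : tensor (gtotal V) T -> W, linear g &
    forall h t, g (tens (hval h) t) = F h t.
Proof.
move=> Fr Fl.
have /choice[K KP] : forall t, exists K : gtotal V -> W,
    linear K /\ forall j (v : V j), K (dsinj j v) = F (mkhel v) t.
  move=> t; have [K KL KE] := dsum_lift (fun j => Fl j t).
  by exists K.
have [|x|g gL gE] := @tensor_lift R (gtotal V) T W (fun x t => K t x).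
- by move=> t; case: (KP t).
- move=> c t t'; elim/dsum_ind: x => [|j v x IHx].
    by rewrite !(lin0 (KP _).1) scaler0 addr0.
  rewrite !(linD (KP _).1) IHx !(KP _).2 Fr scalerDr.
  by rewrite -!addrA; congr (_ + _); rewrite addrCA.
- by exists g => // -[j v] t; rewrite gE (KP t).2.
Qed.

Lemma tpow_ext W n (g g' : tpow (gtotal V) n -> W) : linear g -> linear g' ->
  (forall a, size a = n -> g (tpure n (vals a)) = g' (tpure n (vals a))) ->
  g =1 g'.
Proof.
elim: n g g' => [|n IHn] g g' gL gL' gg' x.
  have E (f : R^o -> W) : linear f -> f x = (x : R) *: f 1.
    by move=> fL; have := fL x 1 0; rewrite (lin0 fL) !addr0 [x *: _]mulr1.
  by rewrite (E g) // (E g') // -[1]/(tpure 0 (@vals R V [::])) gg'.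
apply: gtensor_ext x => // h; apply: IHn => [||a an].
- by apply: lin_comp => //; apply: tens_linearr.
- by apply: lin_comp => //; apply: tens_linearr.
- by have := gg' (h :: a); rewrite /= an; apply.
Qed.

Lemma tpow_lift W n (F : seq (hel V) -> W) :
  (forall a1 a2 j c (x y : V j),
     F (a1 ++ mkhel (c *: x + y) :: a2) =
     c *: F (a1 ++ mkhel x :: a2) + F (a1 ++ mkhel y :: a2)) ->
  exists2 g : tpow (gtotal V) n -> W, linear g &
    forall a, size a = n -> g (tpure n (vals a)) = F a.
Proof.
elim: n F => [|n IHn] F FL.
  exists (fun r : R^o => (r : R) *: F [::]).
    move=> c x y; have := scalerDl (F [::]) (c * x) y.
    by rewrite -scalerA; apply.
  by move=> a /size0nil ->; rewrite /= scale1r.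
have /choice[G GP] : forall h : hel V, exists g : tpow (gtotal V) n -> W,
    linear g /\ forall a, size a = n -> g (tpure n (vals a)) = F (h :: a).
  move=> h; have [|g gL gE] := IHn (fun a => F (h :: a)); last by exists g.
  by move=> a1 a2 j c x y; apply: (FL (h :: a1)).
have [h|j t|g gL gE] := @gtensor_lift (tpow (gtotal V) n) W G.
- exact: (GP h).1.
- move=> c x y; move: t; apply: tpow_ext.
  + exact: (GP _).1.
  + by apply: lin_comb; apply: (GP _).1.
  + by move=> a an; rewrite !(GP _).2 // (FL [::]).
- exists g => // -[//|h a] /= [an].
  by rewrite gE (GP h).2.
Qed.

End Graded.

Variable A : ainf_algebra R.
Local Notation tA := (gtotal (alg_mod A)).
Local Notation hA := (hel (alg_mod A)).
Variable M : ainf_bimodule A.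
Local Notation tM := (gtotal (bimod_mod M)).
Local Notation hM := (hel (bimod_mod M)).

Lemma chainE n (x : tM) (s : seq tA) : size s = n ->
  chain x s = dsinj (V := fun n : nat => tensor tM (tpow tA n)) n
    (tens x (tpure n s)).
Proof. by move=> <-. Qed.

Lemma CH_ext (W : lmodType R) (g g' : CH M -> W) : linear g -> linear g' ->
  (forall (m : hM) (a : seq hA), g (chain (hval m) (vals a)) =
                                 g' (chain (hval m) (vals a))) ->
  g =1 g'.
Proof.
move=> gL gL' gg' x.
elim/dsum_ind: x => [|n u x IHx]; first by rewrite !lin0.
rewrite (linD gL) (linD gL') IHx; congr (_ + _); move: u {x IHx}.
have iL := @dsinj_linear _ _ (fun n : nat => tensor tM (tpow tA n)) n.
apply: gtensor_ext => [||m].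
- exact: lin_comp.
- exact: lin_comp.
apply: tpow_ext.
- by do 2!apply: lin_comp => //; apply: tens_linearr.
- by do 2!apply: lin_comp => //; apply: tens_linearr.
- by move=> a an; rewrite -chainE ?gg' // size_map.
Qed.

(* A multilinear assignment on homogeneous elements extends to a unique
   R-linear map on chains (uniqueness is CH_ext). *)
Lemma CH_lift (W : lmodType R) (F : hM -> seq hA -> W) : hmultilinear F ->
  exists g : {linear CH M -> W},
    forall m a, g (chain (hval m) (vals a)) = F m a.
Proof.
move=> [Fl Fr].
have ex n : exists g : tensor tM (tpow tA n) -> W,
    linear g /\ forall m a, size a = n ->
      g (tens (hval m) (tpure n (vals a))) = F m a.
  have /choice[G GP] : forall m, exists g : tpow tA n -> W,
      linear g /\ forall a, size a = n -> g (tpure n (vals a)) = F m a.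
    by move=> m; have [g gL gE] := tpow_lift n (Fr m); exists g.
  have [m|j t|g gL gE] := @gtensor_lift _ _ W G.
  - exact: (GP m).1.
  - move=> c x y; move: t; apply: tpow_ext.
    + exact: (GP _).1.
    + by apply: lin_comb; apply: (GP _).1.
    + by move=> a an; rewrite !(GP _).2.
  - by exists g; split=> // m a an; rewrite gE (GP m).2.
pose GP n := svalP (cid (ex n)).
have [g gL gE] := dsum_lift (fun n => (GP n).1).
pose gLin := GRing.isLinear.Build R (CH M) W _ g gL.
pose gl : {linear CH M -> W} := HB.pack g gLin.
exists gl => m a; rewrite [LHS]/= (chainE _ (size_map _ _)) gE.
exact: (GP _).2.
Qed.

Definition linext (W : lmodType R) (F : hM -> seq hA -> W)
    (FL : hmultilinear F) : {linear CH M -> W} := sval (cid (CH_lift FL)).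

Lemma linextE (W : lmodType R) (F : hM -> seq hA -> W) (FL : hmultilinear F)
    (m : hM) (a : seq hA) :
  linext FL (chain (hval m) (vals a)) = F m a.
Proof. exact: (svalP (cid (CH_lift FL))). Qed.

End Lifting.

Section Multilinearity.
Variable R : comPzRingType.

Section Slots.
Variable V : gmod R.
Implicit Types (a : seq (hel V)) (s t : seq (gtotal V)).

(* The three sequences differ in one entry only, and there the first one is
   the linear combination of the other two with coefficients c and 1. *)
Definition lintriple (c : R) s s' s'' := exists s1 s2 (x y : gtotal V),
  [/\ s = s1 ++ c *: x + y :: s2, s' = s1 ++ x :: s2 & s'' = s1 ++ y :: s2].

Definition htriple (c : R) (p : nat) a a' a'' :=
  exists a1 a2 j (x y : V j), size a1 = p /\
  [/\ a = a1 ++ mkhel (c *: x + y) :: a2, a' = a1 ++ mkhel x :: a2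
    & a'' = a1 ++ mkhel y :: a2].

Lemma htriple_size c p a a' a'' : htriple c p a a' a'' ->
  [/\ size a' = size a, size a'' = size a & (p < size a)%N].
Proof.
move=> [a1 [a2 [j [x [y [<- [-> -> ->]]]]]]]; rewrite !size_cat /=.
by rewrite addnS ltnS leq_addr.
Qed.

Lemma map_slice (S T : Type) (f : S -> T) i j (s : seq S) :
  map f (slice i j s) = slice i j (map f s).
Proof. by rewrite /slice map_drop map_take. Qed.

Lemma htriple_maltese c p a a' a'' i j : htriple c p a a' a'' ->
  maltese i j a' = maltese i j a /\ maltese i j a'' = maltese i j a.
Proof.
move=> [a1 [a2 [k [x [y [_ [-> -> ->]]]]]]].
pose F (s : seq int) := \sum_(d <- slice i j s) (d - 1).
have E b : maltese i j b = F (map (@deg R V) b).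
  by rewrite /F -map_slice big_map.
by rewrite !E !map_cat.
Qed.

Lemma seg_in c p a a' a'' i j : htriple c p a a' a'' -> (i.-1 <= p < j)%N ->
  lintriple c (seg i j a) (seg i j a') (seg i j a'').
Proof.
move=> [a1 [a2 [k [x [y [ap [-> -> ->]]]]]]] /andP[ip pj].
have E h : seg i j (a1 ++ h :: a2) =
    vals (drop i.-1 a1) ++ hval h :: vals (take (j - p).-1 a2).
  rewrite /seg /slice take_cat ap ltnNge (ltnW pj) /=.
  have -> : (j - p = (j - p).-1.+1)%N by rewrite prednK // subn_gt0.
  rewrite drop_cat ap; move: ip; rewrite leq_eqVlt => /predU1P[->|ip].
    by rewrite ltnn subnn /= drop_oversize ?ap.
  by rewrite ip /vals map_cat.
exists (vals (drop i.-1 a1)), (vals (take (j - p).-1 a2)).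
exists (dsinj k x), (dsinj k y); split; rewrite E //.
by rewrite /hval /= linearP.
Qed.

Lemma seg_out c p a a' a'' i j : htriple c p a a' a'' -> ~~ (i.-1 <= p < j)%N ->
  seg i j a' = seg i j a /\ seg i j a'' = seg i j a.
Proof.
move=> [a1 [a2 [k [x [y [ap [-> -> ->]]]]]]] pij.
have E h h' : seg i j (a1 ++ h :: a2) = seg i j (a1 ++ h' :: a2).
  rewrite /seg /slice; congr (map _ _); move: pij.
  rewrite negb_and -ltnNge -leqNgt => /orP[pi|jp]; last first.
    by rewrite !takel_cat ?ap.
  have [ji|ij] := leqP j i.-1.
    by rewrite !drop_oversize // size_take_min geq_min ji.
  rewrite !take_cat ap ltnNge (leq_trans _ (ltnW ij)) ?(ltnW pi) //=.
  rewrite !drop_cat ap ltnNge (ltnW pi) /=.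
  case: (j - p)%N => [//|n] /=.
  by have -> : (i.-1 - p = (i.-1 - p).-1.+1)%N by rewrite prednK // subn_gt0.
by split; apply: E.
Qed.

Lemma lintriple_size c s s' s'' : lintriple c s s' s'' ->
  size s' = size s /\ size s'' = size s.
Proof. by move=> [s1 [s2 [x [y [-> -> ->]]]]]; rewrite !size_cat. Qed.

Lemma lintriple_cat c s s' s'' t u : lintriple c s s' s'' ->
  lintriple c (t ++ s ++ u) (t ++ s' ++ u) (t ++ s'' ++ u).
Proof.
move=> [s1 [s2 [x [y [-> -> ->]]]]].
by exists (t ++ s1), (s2 ++ u), x, y; rewrite -!catA.
Qed.

Lemma tpure_lin c n s s' s'' : size s = n -> lintriple c s s' s'' ->
  tpure n s = c *: tpure n s' + tpure n s''.
Proof.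
move=> sn [s1 [s2 [x [y [E -> ->]]]]]; move: sn; rewrite E => {E}.
elim: s1 n => [|z s1 IHs] [|n] //= [sn].
- by rewrite (tens_linearl _ c x y).
- by rewrite (IHs n sn) tens_linearr.
Qed.

End Slots.

Variable A : ainf_algebra R.
Local Notation tA := (gtotal (alg_mod A)).
Local Notation hA := (hel (alg_mod A)).
Implicit Types (a : seq hA) (s t : seq tA).

Lemma mu_lin c s s' s'' : lintriple c s s' s'' ->
  mu s = c *: mu s' + mu s''.
Proof.
move=> /[dup] sss /lintriple_size[s1 s2]; rewrite /mu /app_ops s1 s2 -linearP.
congr (alg_ops A _ _); apply: (tpure_lin _ sss).
by case: sss => t1 [t2 [x [y [-> _ _]]]]; rewrite size_cat /= addnS.
Qed.

Section Ops.
Variables (M N : gmod R) (f : bimod_ops A M N).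
Let g := app_bimod_ops f.

Lemma ops_linl c s s' s'' x t : lintriple c s s' s'' ->
  g s x t = c *: g s' x t + g s'' x t.
Proof.
move=> /[dup] sss /lintriple_size[s1 s2]; rewrite /g /app_bimod_ops s1 s2 -linearP.
by rewrite (tpure_lin erefl sss) tens_linearl.
Qed.

Lemma ops_linr c s t t' t'' x : lintriple c t t' t'' ->
  g s x t = c *: g s x t' + g s x t''.
Proof.
move=> /[dup] sss /lintriple_size[s1 s2]; rewrite /g /app_bimod_ops s1 s2 -linearP.
by rewrite (tpure_lin erefl sss) !tens_linearr.
Qed.

Lemma ops_lin s t : linear (fun x => g s x t).
Proof.
move=> c x y; rewrite /g /app_bimod_ops -linearP; congr (f _ _ _).
by rewrite -tens_linearr; congr tens; apply: (tens_linearl _ c x y).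
Qed.
End Ops.

Section ChainLin.
Variable M : ainf_bimodule A.
Local Notation tM := (gtotal (bimod_mod M)).

Lemma chain_linr (x : tM) c s s' s'' : lintriple c s s' s'' ->
  chain x s = c *: chain x s' + chain x s''.
Proof.
move=> /[dup] sss /lintriple_size[s1 s2].
rewrite (chainE x s1) (chainE x s2) -linearP -tens_linearr.
by rewrite -(tpure_lin erefl sss).
Qed.

Lemma chain_linl s : linear (fun x : tM => chain x s).
Proof.
move=> c x y; rewrite /chain -linearP; congr dsinj.
exact: (tens_linearl _ c x y).
Qed.

Lemma outer_lin (L : gmod R) (f : bimod_ops A L (bimod_mod M)) (x : gtotal L)
    c p a a' a'' (i k n : nat) : htriple c p a a' a'' -> (i <= k)%N ->
  n = size a ->
  let F b := chain (app_bimod_ops f (seg k.+1 n b) x (seg 1 i b))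
               (seg i.+1 k b) in
  F a = c *: F a' + F a''.
Proof.
move=> H ik nE F; rewrite {}/F.
have pn : (p < n)%N by rewrite nE; case: (htriple_size H).
have [pi|ip] := ltnP p i.
  have pk : (p < k)%N := leq_trans pi ik.
  have [|-> ->] := seg_out (i := k.+1) (j := n) H; first by rewrite /= leqNgt pk.
  have [|-> ->] := seg_out (i := i.+1) (j := k) H; first by rewrite /= leqNgt pi.
  rewrite (ops_linr _ _ _ (seg_in (i := 1) (j := i) H _)) //.
  exact: chain_linl.
have [|-> ->] := seg_out (i := 1) (j := i) H; first by rewrite /= ltnNge ip.
have [pk|kp] := ltnP p k.
  have [|-> ->] := seg_out (i := k.+1) (j := n) H; first by rewrite /= leqNgt pk.
  by rewrite (chain_linr _ (seg_in (i := i.+1) (j := k) H _)) //= ip.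
have [|-> ->] := seg_out (i := i.+1) (j := k) H.
  by rewrite /= negb_and -leqNgt kp orbT.
rewrite (ops_linl _ _ _ (seg_in (i := k.+1) (j := n) H _)) ?kp //.
exact: chain_linl.
Qed.

Lemma inner_lin (x : tM) c p a a' a'' (i k n : nat) : htriple c p a a' a'' ->
  (i <= k <= n)%N -> n = size a ->
  let F b := chain x (seg 1 i b ++ mu (seg i.+1 k b) :: seg k.+1 n b) in
  F a = c *: F a' + F a''.
Proof.
move=> H /andP[ik kn] nE F; rewrite {}/F.
have pn : (p < n)%N by rewrite nE; case: (htriple_size H).
have [pi|ip] := ltnP p i.
  have pk : (p < k)%N := leq_trans pi ik.
  have [|-> ->] := seg_out (i := k.+1) (j := n) H; first by rewrite /= leqNgt pk.
  have [|-> ->] := seg_out (i := i.+1) (j := k) H; first by rewrite /= leqNgt pi.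
  apply: chain_linr.
  exact: (lintriple_cat [::] _ (seg_in (i := 1) (j := i) H _)).
have [|-> ->] := seg_out (i := 1) (j := i) H; first by rewrite /= ltnNge ip.
apply: chain_linr; have [pk|kp] := ltnP p k.
  have [|-> ->] := seg_out (i := k.+1) (j := n) H; first by rewrite /= leqNgt pk.
  rewrite (mu_lin (seg_in (i := i.+1) (j := k) H _)) /= ?ip //.
  by do 4!eexists; split.
have [|-> ->] := seg_out (i := i.+1) (j := k) H.
  by rewrite /= negb_and -leqNgt kp orbT.
have := seg_in (i := k.+1) (j := n) H; rewrite /= kp pn => /(_ isT) T.
have := lintriple_cat (seg 1 i a ++ [:: mu (seg i.+1 k a)]) [::] T.
by rewrite !cats0 -!catA.
Qed.

End ChainLin.

Lemma scale_lin (W : lmodType R) (e c : R) (u v w : W) : u = c *: v + w ->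
  e *: u = c *: (e *: v) + e *: w.
Proof. by move=> ->; rewrite scalerDr !scalerA mulrC. Qed.

Lemma sum_lin (W : lmodType R) (c : R) (m n : nat) (F G H : nat -> W) :
  (forall i, (m <= i < n)%N -> F i = c *: G i + H i) ->
  \sum_(m <= i < n) F i = c *: (\sum_(m <= i < n) G i) + \sum_(m <= i < n) H i.
Proof.
move=> FGH; rewrite scaler_sumr -big_split /=.
by apply: eq_big_nat.
Qed.

Lemma add_lin (W : lmodType R) (c : R) (u v w u' v' w' : W) :
  u = c *: v + w -> u' = c *: v' + w' ->
  u + u' = c *: (v + v') + (w + w').
Proof. by move=> -> ->; rewrite scalerDr addrACA. Qed.

End Multilinearity.

Section HochschildDifferential.
Variables (R : comPzRingType) (A : ainf_algebra R) (M : ainf_bimodule A).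
Local Notation hA := (hel (alg_mod A)).
Local Notation hM := (hel (bimod_mod M)).

Definition hochschild_formula (m : hM) (a : seq hA) : CH M :=
  let n := size a in
  \sum_(1 <= l < n.+2)
   (chain (muB (M := M) [::] (hval m) (seg 1 (l - 1) a)) (seg l n a)
    + \sum_(1 <= i < n.+2 - l)
        sgn R (maltese0 m (i - 1) a) *:
          chain (hval m)
            (seg 1 (i - 1) a ++ mu (seg i (i + l - 1) a) :: seg (i + l) n a)
    + \sum_(n.+2 - l <= i < n.+1 | (1 <= i)%N)
        sgn R (star m (i - 1) a) *:
          chain (muB (M := M) (seg i n a) (hval m) (seg 1 (i + l - n - 2) a))
                (seg (i + l - n - 1) (i - 1) a)).

Lemma hval_lin (V : gmod R) c j (x y : V j) :
  hval (mkhel (c *: x + y)) = c *: hval (mkhel x) + hval (mkhel y).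
Proof. by rewrite /hval /= linearP. Qed.

Lemma hochschild_multilinear : hmultilinear hochschild_formula.
Proof.
split=> [a j c x y|m a1 a2 j c x y].
  rewrite /hochschild_formula; apply: sum_lin => l _.
  apply: add_lin; [apply: add_lin|].
  - by rewrite hval_lin /muB ops_lin chain_linl.
  - by apply: sum_lin => i _; apply: scale_lin; rewrite hval_lin chain_linl.
  - rewrite !(big_mkcond (fun i => 1 <= i)%N) /=.
    apply: sum_lin => i _; case: ifP => _; last by rewrite scaler0 addr0.
    by apply: scale_lin; rewrite hval_lin /muB ops_lin chain_linl.
set a := a1 ++ _ :: _; set a' := a1 ++ _ :: _; set a'' := a1 ++ mkhel y :: _.
have H : htriple c (size a1) a a' a'' by exists a1, a2, j, x, y.
have [s1 s2 _] := htriple_size H.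
have D i k := htriple_maltese i k H.
rewrite /hochschild_formula s1 s2; set n := size a.
apply: sum_lin => l /andP[l0 ln]; apply: add_lin; [apply: add_lin|].
- have [l' E] : exists l', l = l'.+1 by case: l l0 {ln} => // l' _; exists l'.
  rewrite E subn1 /=.
  have l'n : (l' <= n)%N by rewrite E in ln.
  have := outer_lin (@bimod_op _ _ M) (hval m) H l'n erefl.
  have E0 b : size b = n -> seg n.+1 n b = [::].
    by move=> bn; rewrite /seg /slice drop_oversize // size_take_min bn minnn.
  by rewrite /= !E0.
- apply: sum_lin => i /andP[i0 il].
  have [-> ->] : maltese0 m (i - 1) a' = maltese0 m (i - 1) a /\
      maltese0 m (i - 1) a'' = maltese0 m (i - 1) a.
    by rewrite /maltese0; have [-> ->] := D 1%N (i - 1)%N.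
  apply: scale_lin.
  have iln : (i - 1 <= i + l - 1 <= n)%N by lia.
  have := inner_lin (hval m) H iln erefl.
  have -> : (i - 1).+1 = i by lia.
  by have -> : (i + l - 1).+1 = (i + l)%N by lia.
- rewrite !(big_mkcond (fun i => 1 <= i)%N) /=.
  apply: sum_lin => i /andP[i0 il].
  case: ifP => i1; last by rewrite scaler0 addr0.
  rewrite /star /maltese0 s1 s2 !(D _ _).1 !(D _ _).2.
  apply: scale_lin.
  have iln : (i + l - n - 2 <= i - 1)%N by lia.
  have := outer_lin (@bimod_op _ _ M) (hval m) H iln erefl.
  have -> : (i - 1).+1 = i by lia.
  by have -> : (i + l - n - 2).+1 = (i + l - n - 1)%N by lia.
Qed.

Definition hochschild_b : {linear CH M -> CH M} := linext hochschild_multilinear.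

Lemma hochschild_bE (m : hM) (a : seq hA) :
  hochschild_b (chain (hval m) (vals a)) = hochschild_formula m a.
Proof. exact: linextE. Qed.

End HochschildDifferential.

Arguments hochschild_b {R A} M.

Section InducedMap.
Variables (R : comPzRingType) (A : ainf_algebra R) (M N : ainf_bimodule A).
Variables (d : int) (f : bimod_morphism M N d).
Local Notation hA := (hel (alg_mod A)).
Local Notation hM := (hel (bimod_mod M)).

Definition fbar (r s : nat) (m : hM) (a : seq hA) : CH N :=
  let n := size a in
  if (r + s <= n)%N
  then chain (mor f (seg (n - r + 1) n a) (hval m) (seg 1 s a))
             (seg (s + 1) (n - r) a)
  else 0.

(* The terms with r > n or s > n vanish. *)
Definition induced_formula (m : hM) (a : seq hA) : CH N :=
  let n := size a in
  \sum_(0 <= r < n.+1) \sum_(0 <= s < n.+1)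
    sgn R (star m (n - r) a + d * chain_deg m a) *: fbar r s m a.

Lemma induced_multilinear : hmultilinear induced_formula.
Proof.
split=> [a j c x y|m a1 a2 j c x y].
  rewrite /induced_formula; do 2![apply: sum_lin => ? _]; apply: scale_lin.
  rewrite /fbar; case: ifP => _; last by rewrite scaler0 addr0.
  by rewrite hval_lin /mor ops_lin chain_linl.
set a := a1 ++ _ :: _; set a' := a1 ++ _ :: _; set a'' := a1 ++ mkhel y :: _.
have H : htriple c (size a1) a a' a'' by exists a1, a2, j, x, y.
have [s1 s2 _] := htriple_size H.
have D i k := htriple_maltese i k H.
rewrite /induced_formula s1 s2; set n := size a.
do 2![apply: sum_lin => ? _].
rewrite /star /maltese0 s1 s2 !(D _ _).1 !(D _ _).2.
have [-> ->] : chain_deg m a' = chain_deg m a /\ chain_deg m a'' = chain_deg m a.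
  rewrite /chain_deg s1 s2 /a /a' /a'' !big_cat !big_cons.
  by split.
apply: scale_lin; rewrite /fbar s1 s2.
case: ifP => rsn; last by rewrite scaler0 addr0.
rewrite !addn1; apply: (outer_lin _ _ H) => //.
by rewrite leq_subRL // (leq_trans _ rsn) // leq_addr.
Qed.

Definition induced_map : {linear CH M -> CH N} := linext induced_multilinear.

Lemma induced_mapE (m : hM) (a : seq hA) :
  induced_map (chain (hval m) (vals a)) = induced_formula m a.
Proof. exact: linextE. Qed.

End InducedMap.

(* Main.v *)
Require Import Defs.
From HB Require Import structures.
From mathcomp Require Import all_boot all_order all_algebra.
From mathcomp Require Import zify.
Set Implicit Arguments.
Unset Strict Implicit.
Unset Printing Implicit Defensive.
Import GRing.Theory.
Local Open Scope ring_scope.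

(** Give [m] its degree and every algebra element its reduced degree
    [deg a - 1].  Every operation of the algebra and of the bimodules then has
    degree 1, [f] has degree [d], and all signs are Koszul signs: a chain
    [m (x) a_1 (x) ... (x) a_n] is a word written on a circle, and both [b] and
    [f_*] sum over all ways to rotate a final block of algebra letters in front
    of [m] and to apply an operation to an arc; [b] applies the bimodule
    operation to an arc containing [m] or [mu] to an arc of algebra letters,
    [f_*] applies [f] to an arc containing [m].  As [f_*] carries the extra sign
    [d * deg], and [b] lowers the degree by one, the two composites agree up to
    the sign rule [mu o f = (-1)^d f o mu] of a bimodule morphism:

    - in [b o f_*], the letter produced by [f] is either absorbed by the
      operation of [N], or [mu] acts on an arc disjoint from that of [f];
    - in [f_* o b], the letter produced by [b] is either absorbed by [f], or it
      is an output of [mu] lying outside the arc of [f].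

    The terms with disjoint arcs agree one by one.  For the others, fix the arc
    [x m y] covered by the two operations and the word [q] left over, so that
    the algebra letters read [a = y q x]; summing over all operations supported
    on that arc gives the morphism relation for [(x, m, y)], tensored with
    [q].

    To avoid index bookkeeping, all sums are turned into sums over ways of
    cutting a word into consecutive pieces ([deconc], [deconc3], [deconc5]).
    Reordering them is coassociativity of deconcatenation, and [f_*] of a word
    with an inserted letter [mu(v)] is evaluated by [deconc3_insert].  The three
    formulas at stake become [hochschild_deconc], [induced_deconc] and
    [morphism_deconc]; the comparison is [hochschild_induced],
    [induced_hochschild] and [rotated_morphism_relation]. *)

(** * Sums over the ways of cutting a word *)

Section Deconcatenation.
Variables (T : Type) (W : zmodType).
Implicit Types (a u v : seq T).

Definition deconc (F : seq T -> seq T -> W) a : W :=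
  \sum_(0 <= i < (size a).+1) F (take i a) (drop i a).

Definition deconc3 (F : seq T -> seq T -> seq T -> W) a : W :=
  deconc (fun u => deconc (F u)) a.

Lemma eq_deconc F G a :
  (forall u v, u ++ v = a -> F u v = G u v) -> deconc F a = deconc G a.
Proof. by move=> FG; apply: eq_bigr => i _; rewrite FG // cat_take_drop. Qed.

Lemma eq_deconc3 F G a :
  (forall u v w, u ++ v ++ w = a -> F u v w = G u v w) ->
  deconc3 F a = deconc3 G a.
Proof.
move=> FG; apply: eq_deconc => u b ub.
by apply: eq_deconc => v w vw; apply: FG; rewrite vw.
Qed.

Lemma deconc_nil F : deconc F [::] = F [::] [::].
Proof. by rewrite /deconc big_nat1. Qed.

Lemma deconc_cons F h a :
  deconc F (h :: a) = F [::] (h :: a) + deconc (fun u => F (h :: u)) a.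
Proof. by rewrite /deconc big_nat_recl. Qed.

Lemma deconcD F G a :
  deconc (fun u v => F u v + G u v) a = deconc F a + deconc G a.
Proof. exact: big_split. Qed.

Lemma deconc3D F G a :
  deconc3 (fun u v w => F u v w + G u v w) a = deconc3 F a + deconc3 G a.
Proof. by rewrite -deconcD; apply: eq_deconc => u v _; rewrite deconcD. Qed.

Lemma exchange_deconc (F : seq T -> seq T -> seq T -> seq T -> W) a b :
  deconc (fun u v => deconc (F u v) b) a =
  deconc (fun s t => deconc (fun u v => F u v s t) a) b.
Proof. exact: exchange_big. Qed.

(** Coassociativity: both sides sum over the ways of cutting [a] into three. *)
Lemma deconcA F a :
  deconc (fun v w => deconc (fun u v => F u v w) v) a = deconc3 F a.
Proof.
rewrite /deconc3; elim: a F => [|h a IHa] F; first by rewrite !deconc_nil.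
rewrite !deconc_cons deconc_nil -addrA; congr (_ + _).
rewrite -(IHa (fun u => F (h :: u))) -deconcD.
by apply: eq_deconc => u v _; rewrite deconc_cons.
Qed.

(** The cut falls on one side or the other of the marked letter [h]. *)
Lemma deconc_insert F h x y : deconc F (x ++ h :: y) =
  deconc (fun x1 x2 => F x1 (x2 ++ h :: y)) x
  + deconc (fun y1 y2 => F (x ++ h :: y1) y2) y.
Proof.
elim: x F => [|k x IHx] F /=; first by rewrite deconc_cons deconc_nil.
by rewrite !deconc_cons IHx addrA.
Qed.

(** The marked letter [h] lies in the last, the middle or the first of the
    three pieces. *)
Lemma deconc3_insert F h x y : deconc3 F (x ++ h :: y) =
  deconc3 (fun u v w => F u v (w ++ h :: y)) x
  + deconc (fun x1 x2 => deconc (fun y1 y2 => F x1 (x2 ++ h :: y1) y2) y) x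
  + deconc3 (fun u => F (x ++ h :: u)) y.
Proof.
rewrite /deconc3 deconc_insert -deconcD; congr (_ + _).
by apply: eq_deconc => u v _; rewrite deconc_insert.
Qed.

Section FiveFold.
Variable F : seq T -> seq T -> seq T -> seq T -> seq T -> W.

(** Cuttings of [a] into five pieces arise from cuttings into three, one or two
    pieces of which are cut again.  Which ones depends on the operations being
    composed; cutting the middle piece serves as the normal form. *)
Definition deconc5 a :=
  deconc3 (fun u v w => deconc3 (fun p q r => F u p q r w) v) a.

Lemma deconc5_left a :
  deconc3 (fun y q x => deconc3 (fun u p p' => F u p p' q x) y) a = deconc5 a.
Proof.
rewrite /deconc5 -[LHS]deconcA -[RHS]deconcA; apply: eq_deconc => b x _.
rewrite (deconcA (fun u y' q => deconc (fun p p' => F u p p' q x) y')).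
by apply: eq_deconc => u c _; rewrite deconcA.
Qed.

Lemma deconc5_right a :
  deconc3 (fun y q x => deconc3 (fun r s w => F y q r s w) x) a = deconc5 a.
Proof.
apply: eq_deconc => y b _.
rewrite (deconcA (fun q z w => deconc (fun r s => F y q r s w) z)).
by apply: eq_deconc => q x _; rewrite deconcA.
Qed.

Lemma deconc5_sides a :
  deconc3 (fun y q x =>
    deconc (fun u p => deconc (fun r w => F u p q r w) x) y) a = deconc5 a.
Proof.
rewrite -deconc5_right -[LHS]deconcA.
transitivity (deconc (fun b x => deconc3 (fun u p q =>
   deconc (fun r w => F u p q r w) x) b) a).
  by apply: eq_deconc => b x _; rewrite deconcA.
rewrite (deconcA (fun u d x => deconc (fun p q => deconc (F u p q) x) d)).
apply: eq_deconc => u d _.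
by rewrite (deconcA (fun p q x => deconc (F u p q) x)).
Qed.
End FiveFold.

End Deconcatenation.

Section DeconcatenationMorphism.
Variables (T : Type) (R : comPzRingType) (W W' : lmodType R).
Implicit Types a : seq T.

Lemma linear_deconc (g : W -> W') F a : linear g ->
  g (deconc F a) = deconc (fun u v => g (F u v)) a.
Proof. by move=> gL; apply: big_morph; [apply: linD | apply: lin0]. Qed.

Lemma linear_deconc3 (g : W -> W') F a : linear g ->
  g (deconc3 F a) = deconc3 (fun u v w => g (F u v w)) a.
Proof.
move=> gL; rewrite linear_deconc //; apply: eq_deconc => u v _.
exact: linear_deconc.
Qed.

Lemma scaler_deconc c (F : seq T -> seq T -> W) a :
  c *: deconc F a = deconc (fun u v => c *: F u v) a.
Proof. exact: scaler_sumr. Qed.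

Lemma scaler_deconc3 c (F : seq T -> seq T -> seq T -> W) a :
  c *: deconc3 F a = deconc3 (fun u v w => c *: F u v w) a.
Proof.
by rewrite scaler_deconc; apply: eq_deconc => u v _; apply: scaler_deconc.
Qed.

End DeconcatenationMorphism.

(** * From sums over indices to sums over cuttings *)

Section IndexedSums.
Variables (T : Type) (W : zmodType).
Implicit Types (a : seq T) (F : seq T -> seq T -> seq T -> W).

Lemma deconc3_cuts F a : deconc3 F a =
  \sum_(0 <= q < (size a).+1) \sum_(0 <= p < q.+1)
     F (take p a) (drop p (take q a)) (drop q a).
Proof.
rewrite -deconcA; apply: eq_big_nat => q; rewrite ltnS => /= qa.
rewrite /deconc size_takel //; apply: eq_big_nat => p /= pq.
by rewrite take_takel.
Qed.

(** Sums over the length [l] and the starting point [i] of the arc on which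
    [mu] acts; that arc is nonempty because there is no operation with zero
    inputs. *)
Lemma sum_insertions F a :
  \sum_(1 <= l < (size a).+1) \sum_(1 <= i < (size a).+2 - l)
     F (slice 1 (i - 1) a) (slice i (i + l - 1) a) (slice (i + l) (size a) a) =
  deconc3 (fun u v w => if nilp v then 0 else F u v w) a.
Proof.
set n := size a.
pose G j l := F (take j a) (take l (drop j a)) (drop l (drop j a)).
transitivity (\sum_(1 <= l < n.+1) \sum_(0 <= j < n.+1 | (j < n.+1 - l)%N) G j l).
  apply: eq_big_nat => l /andP[l0 ln].
  rewrite (_ : n.+2 - l = (n.+1 - l).+1)%N; last by lia.
  rewrite big_add1 /= (big_nat_widen _ _ n.+1) ?leq_subr //=.
  apply: eq_bigr => j _; rewrite /G /slice subn1 /= drop0.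
  by rewrite addSn subn1 /= take_size drop_drop take_drop (addnC l).
rewrite (exchange_big_dep_nat xpredT) //=; apply: eq_big_nat => j /= jn.
rewrite /deconc size_drop -/n big_ltn // take0 /= add0r.
rewrite (_ : (n - j).+1 = n.+1 - j)%N; last by lia.
rewrite [RHS](big_nat_widen _ _ n.+1) ?leq_subr // big_nat_cond [RHS]big_nat_cond.
apply: eq_big => [l|l /andP[/andP[l0 _] lj]]; first by lia.
rewrite /nilp size_takel; last by rewrite size_drop; lia.
by rewrite eqn0Ngt l0.
Qed.

(** The two kinds of terms of [b] in which the bimodule acts merge into one sum:
    the first kind is the case where no letter is rotated in front of [m],
    i.e. the third piece is empty. *)
Lemma sum_rotations F a : let n := size a in
  \sum_(1 <= l < n.+2)
    (F (slice 1 (l - 1) a) (slice l n a) [::]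
     + \sum_(n.+2 - l <= i < n.+1 | (1 <= i)%N)
         F (slice 1 (i + l - n - 2) a) (slice (i + l - n - 1) (i - 1) a)
           (slice i n a)) =
  deconc3 F a.
Proof.
move=> n; rewrite deconc3_cuts -/n [RHS]big_nat_recr //= [LHS]big_split /= addrC.
congr (_ + _); last first.
  rewrite big_add1 /=; apply: eq_big_nat => p _.
  by rewrite /slice subn1 take_size drop_size drop0.
pose G p q := F (take p a) (drop p (take q a)) (drop q a).
transitivity (\sum_(1 <= l < n.+2) \sum_(1 <= i < n.+1 | (n.+2 - l <= i)%N)
                G (i + l - n - 2)%N (i - 1)%N).
  apply: eq_big_nat => l /andP[l0 ln].
  have -> : \sum_(n.+2 - l <= i < n.+1 | (0 < i)%N)
      F (slice 1 (i + l - n - 2) a) (slice (i + l - n - 1) (i - 1) a)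
           (slice i n a) = \sum_(n.+2 - l <= i < n.+1 | (0 < i)%N)
      G (i + l - n - 2)%N (i - 1)%N.
    rewrite big_nat_cond [RHS]big_nat_cond; apply: eq_bigr => i il.
    rewrite /G /slice /= drop0 take_size.
    by congr (F _ (drop _ _) (drop _ _)); lia.
  rewrite [LHS](big_nat_widenl _ 0%N) // [RHS](big_nat_widenl _ 0%N) //.
  by apply: eq_bigl => i; rewrite andbC.
rewrite (exchange_big_dep_nat xpredT) //= big_add1 /=.
apply: eq_big_nat => q /= qn.
(* the first cut is at p = l - (n + 1 - q), which runs over [0, q] *)
transitivity (\sum_(0 + (n.+1 - q) <= l < n.+2) G (q.+1 + l - n - 2)%N q).
  rewrite [RHS](big_nat_widenl _ 1%N) ?subn_gt0 //; last by lia.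
  by rewrite subn1; apply: eq_bigl => l; lia.
rewrite big_addn (_ : n.+2 - _ = q.+1)%N; last by lia.
by apply: eq_big_nat => p _; congr (G _ _); lia.
Qed.

(** [r] letters are taken from the end of [a] and [s] from its beginning. *)
Lemma sum_two_ends F a : let n := size a in
  \sum_(0 <= r < n.+1) \sum_(0 <= s < n.+1 | (r + s <= n)%N)
     F (slice 1 s a) (slice (s + 1) (n - r) a) (slice (n - r + 1) n a) =
  deconc3 F a.
Proof.
move=> n; rewrite deconc3_cuts -/n [RHS]big_nat_rev /= add0n.
apply: eq_big_nat => r /= rn; rewrite subSS.
rewrite (big_nat_widen _ (n - r).+1 n.+1) ?ltnS ?leq_subr //=.
apply: eq_big => [s|s _]; first by lia.
by rewrite /slice /= drop0 !addn1 /= take_size.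
Qed.

End IndexedSums.

(** * Signs and reduced degrees *)

Section Signs.
Variable R : comPzRingType.

Lemma odd_absz_add (i j : int) : odd `|(i + j)%R|%N = odd `|i|%N (+) odd `|j|%N.
Proof. lia. Qed.

Lemma odd_absz_mul (i j : int) : odd `|(i * j)%R|%N = odd `|i|%N && odd `|j|%N.
Proof. by rewrite abszM oddM. Qed.

Lemma sgnE (i : int) : sgn R i = (-1) ^+ odd `|i|%N.
Proof. by rewrite /sgn signr_odd. Qed.

Lemma scaler_sgn (W : lmodType R) i j (x : W) :
  sgn R i *: (sgn R j *: x) = sgn R (i + j) *: x.
Proof. by rewrite scalerA !sgnE odd_absz_add signr_addb. Qed.

End Signs.

(** Equality of two signs whose exponents are polynomials in degrees: reduce
    to parities, then to a boolean tautology. *)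
Ltac sgn_parity :=
  rewrite !sgnE; congr (_ ^+ nat_of_bool _);
  rewrite ?(odd_absz_add, odd_absz_mul, abszN) /=;
  repeat match goal with |- context [odd (absz ?x)] => case: (odd (absz x)) end;
  by [].

Section ReducedDegree.
Variables (R : comPzRingType) (V : gmod R).
Implicit Types a u v : seq (hel V).

Definition rdeg a : int := \sum_(h <- a) (deg h - 1).

Lemma rdeg_cat u v : rdeg (u ++ v) = rdeg u + rdeg v.
Proof. exact: big_cat. Qed.

Lemma rdeg_cons h a : rdeg (h :: a) = deg h - 1 + rdeg a.
Proof. exact: big_cons. Qed.

Lemma rdegE a : rdeg a = \sum_(h <- a) deg h - (size a)%:Z.
Proof.
elim: a => [|h a IHa]; first by rewrite /rdeg !big_nil.
by rewrite rdeg_cons IHa big_cons /=; lia.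
Qed.

Lemma vals_cat u v : vals (u ++ v) = vals u ++ vals v.
Proof. exact: map_cat. Qed.

Lemma homogeneous_hval j (x : gtotal V) :
  homogeneous j x -> exists h : hel V, x = hval h /\ deg h = j.
Proof. by move=> [v ->]; exists (mkhel v). Qed.

End ReducedDegree.

(** * The three formulas as sums over cuttings *)

Section Operations.
Variables (R : comPzRingType) (A : ainf_algebra R).
Local Notation hA := (hel (alg_mod A)).

(** In reduced degrees, [mu] raises the degree by one.  As its value is
    homogeneous, it can serve as a letter in the formulas for chains. *)
Lemma mu_hval (v : seq hA) : ~~ nilp v ->
  exists h : hA, mu (vals v) = hval h /\ deg h - 1 = rdeg v + 1.
Proof.
rewrite /nilp -lt0n => v0.
have [h [E hd]] := homogeneous_hval (alg_degree v0).
by exists h; split; rewrite // hd rdegE; lia.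
Qed.

(** In reduced degrees, the number of inputs disappears from the degree of an
    operation. *)
Lemma ops_hval (L P : gmod R) k (g : bimod_ops A L P) : bimod_ops_degree k g ->
  forall (x : seq hA) (m : hel L) (y : seq hA),
  exists h : hel P, app_bimod_ops g (vals x) (hval m) (vals y) = hval h
    /\ deg h = rdeg x + deg m + rdeg y + k.
Proof.
move=> gk x m y; have [h [E hd]] := homogeneous_hval (gk x m y).
by exists h; split; rewrite // hd !rdegE; lia.
Qed.

Lemma chain_degE (M : ainf_bimodule A) (m : hel (bimod_mod M)) (a : seq hA) :
  chain_deg m a = - (deg m + rdeg a).
Proof. by rewrite /chain_deg rdegE; lia. Qed.

(** The sign of a rotation is the Koszul sign for moving [w] across [m u v]. *)
Lemma hochschild_deconc (M : ainf_bimodule A) (m : hel (bimod_mod M))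
    (a : seq hA) :
  hochschild_b M (chain (hval m) (vals a)) =
    deconc3 (fun u v w => sgn R ((deg m + rdeg u + rdeg v) * rdeg w) *:
      chain (muB (M := M) (vals w) (hval m) (vals u)) (vals v)) a
    + deconc3 (fun u v w => if nilp v then 0 else sgn R (deg m + rdeg u) *:
        chain (hval m) (vals u ++ mu (vals v) :: vals w)) a.
Proof.
pose turn (u v w : seq hA) := sgn R ((deg m + rdeg u + rdeg v) * rdeg w) *:
  chain (muB (M := M) (vals w) (hval m) (vals u)) (vals v).
pose insert (u v w : seq hA) := sgn R (deg m + rdeg u) *:
  chain (hval m) (vals u ++ mu (vals v) :: vals w).
rewrite -/turn; set n := size a.
rewrite [X in _ = _ + X](_ : _ = \sum_(1 <= l < n.+2) \sum_(1 <= i < n.+2 - l)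
   insert (slice 1 (i - 1) a) (slice i (i + l - 1) a) (slice (i + l) n a));
  last first.
  (* the term l = n + 1 is an empty sum: no arc is that long *)
  rewrite big_nat_recr //= [X in _ + X]big_geq; last by lia.
  by rewrite addr0 sum_insertions.
rewrite hochschild_bE /hochschild_formula -sum_rotations -/n.
rewrite -big_split /=; apply: eq_big_nat => l /andP[l0 ln].
rewrite addrAC; congr (_ + _ + _).
  by rewrite /turn [rdeg [::]]big_nil mulr0 /sgn expr0 scale1r.
rewrite big_nat_cond [RHS]big_nat_cond.
apply: eq_bigr => i /andP[/andP[il iln] i0]; congr (sgn R _ *: _).
have -> : slice i n a = slice (i - 1).+1 n a by congr slice; lia.
congr (_ * _); rewrite /maltese0 -addrA -rdeg_cat; congr (_ + _).
rewrite /maltese -/(rdeg _); congr rdeg.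
have ij : (i + l - n - 2 <= i - 1)%N by lia.
rewrite /slice !drop0 -{1}(cat_take_drop (i + l - n - 2) (take (i - 1) a)).
by rewrite take_takel //; congr (_ ++ drop _ _); lia.
Qed.

Variables (M N : ainf_bimodule A) (d : int) (f : bimod_morphism M N d).

Lemma induced_deconc (m : hel (bimod_mod M)) (a : seq hA) :
  induced_map f (chain (hval m) (vals a)) =
  deconc3 (fun u v w =>
    sgn R ((deg m + rdeg u + rdeg v) * rdeg w + d * (deg m + rdeg a)) *:
      chain (mor f (vals w) (hval m) (vals u)) (vals v)) a.
Proof.
rewrite induced_mapE /induced_formula -sum_two_ends.
apply: eq_big_nat => r /= rn; rewrite [RHS]big_mkcond /=.
apply: eq_big_nat => s /= sn; rewrite /fbar.
case: ifP => rs; last by rewrite scaler0.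
set u := slice 1 s a; set v := slice (s + 1) _ a; set w := slice _ _ a.
rewrite /seg -/u -/v -/w; congr (_ *: _).
have -> : star m (size a - r) a = (deg m + rdeg u + rdeg v) * rdeg w.
  rewrite /star /maltese0 /maltese -/(rdeg _) -/(rdeg _) -addrA -rdeg_cat.
  rewrite /w addn1; congr ((_ + rdeg _) * _).
  rewrite /u /v /slice addn1 !drop0 /=.
  rewrite -{1}(cat_take_drop s (take _ a)) take_takel //; lia.
by rewrite chain_degE; sgn_parity.
Qed.

(** The indices of the morphism relation run over the word [x y]; no piece
    straddles the place of [m], so [x] and [y] can be cut separately. *)
Lemma morphism_deconc (m : hel (bimod_mod M)) (x y : seq hA) :
  deconc (fun x1 x2 => deconc (fun y1 y2 => sgn R (d * rdeg x1) *:
    muB (vals x1) (mor f (vals x2) (hval m) (vals y1)) (vals y2)) y) x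
  = deconc3 (fun u v w => if nilp v then 0 else sgn R (rdeg u + d) *:
      mor f (vals u ++ mu (vals v) :: vals w) (hval m) (vals y)) x
  + deconc (fun x1 x2 => deconc (fun y1 y2 => sgn R (rdeg x1 + d) *:
      mor f (vals x1) (muB (vals x2) (hval m) (vals y1)) (vals y2)) y) x
  + deconc3 (fun u v w => if nilp v then 0 else
      sgn R (rdeg x + rdeg u + deg m + d) *:
      mor f (vals x) (hval m) (vals u ++ mu (vals v) :: vals w)) y.
Proof.
have := @mor_rel _ _ _ _ _ f (size x) (size y) m (x ++ y) (size_cat _ _).
set r := size x; set s := size y => rel.
have slice_l i j : (j <= r)%N -> slice i j (x ++ y) = slice i j x.
  by move=> jr; rewrite /slice takel_cat.
have slice_r i j : slice (r + i).+1 (r + j) (x ++ y) = slice i.+1 j y.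
  rewrite /slice take_cat ltnNge leq_addr /= addKn drop_cat.
  by rewrite ltnNge leq_addr /= addKn.
have slice_take (T : Type) j (z : seq T) : slice 1 j z = take j z.
  exact: drop0.
have slice_drop (T : Type) j (z : seq T) : slice j.+1 (size z) z = drop j z.
  by rewrite /slice take_size.
have sl1 r1 : (r1 < r.+1)%N -> slice 1 r1 (x ++ y) = take r1 x.
  by move=> r1r; rewrite slice_l // slice_take.
have sl2 r1 : slice r1.+1 r (x ++ y) = drop r1 x.
  by rewrite slice_l // slice_drop.
have sl3 s2 : slice r.+1 (r + s2) (x ++ y) = take s2 y.
  by rewrite -[in r.+1](addn0 r) slice_r slice_take.
have sl4 s2 : slice (r + s2).+1 (r + s) (x ++ y) = drop s2 y.
  by rewrite slice_r slice_drop.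
have sl5 : slice r.+1 (r + s) (x ++ y) = y by rewrite sl3 take_size.
transitivity (\sum_(0 <= r1 < r.+1) \sum_(0 <= s2 < s.+1)
     sgn R (d * maltese 1 r1 (x ++ y)) *:
       muB (seg 1 r1 (x ++ y))
           (mor f (seg r1.+1 r (x ++ y)) (hval m) (seg r.+1 (r + s2) (x ++ y)))
           (seg (r + s2).+1 (r + s) (x ++ y))).
  apply: eq_big_nat => r1 /= r1r; apply: eq_big_nat => s2 /= s2s.
  by rewrite /seg /maltese sl1 // sl2 sl3 sl4.
rewrite {}rel; congr (_ + _ + _).
- rewrite -sum_insertions -/r; apply: eq_big_nat => l /andP[l0 lr].
  apply: eq_big_nat => i /andP[i0 il].
  rewrite /maltese /seg sl5 !slice_l //; lia.
- apply: eq_big_nat => r1 /= r1r; apply: eq_big_nat => s2 /= s2s.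
  by rewrite /seg /maltese sl1 // sl2 sl3 sl4.
- rewrite -sum_insertions -/s; apply: eq_big_nat => l /andP[l0 ls].
  apply: eq_big_nat => [[//|i]] /andP[_ il].
  rewrite /maltese /seg.
  have -> : (r + i.+1 - 1 = r + i)%N by lia.
  have -> : (r + i.+1 + l - 1 = r + (i + l))%N by lia.
  have -> : (r + i.+1 + l = (r + (i + l)).+1)%N by lia.
  have -> : slice (r + i.+1) (r + (i + l)) (x ++ y) = slice i.+1 (i + l) y.
    by rewrite addnS slice_r.
  have -> : slice 1 (r + i) (x ++ y) = x ++ take i y.
    by rewrite slice_take take_cat ltnNge leq_addr /= addKn.
  rewrite -/(rdeg _) rdeg_cat sl3 slice_r slice_drop sl1 // take_size.
  by rewrite !slice_take !addSn !subn1.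
Qed.

(** Chains are graded by the opposite of the total reduced degree, which [f]
    raises by [d]. *)
Lemma induced_map_degree (k : int) (x : CH M) :
     x \in CH_deg M k -> induced_map f x \in CH_deg N (k - d).
Proof.
move=> /lspanP xk.
have spanN := lspan_submod (fun y : CH N =>
  exists (m : hel (bimod_mod N)) (a : seq hA),
    chain_deg m a = k - d /\ y = chain (hval m) (vals a)).
apply: (xk (fun y => induced_map f y \in CH_deg N (k - d)));
  last move=> _ [m [a [mk ->]]].
  split=> [|c y z yk zk]; first by rewrite unfold_in linear0 spanN.1.
  by rewrite unfold_in linearP spanN.2.
rewrite unfold_in induced_deconc.
have sum_in (I : seq nat) (F : nat -> CH N) :
    (forall i, F i \in CH_deg N (k - d)) ->
    \sum_(i <- I) F i \in CH_deg N (k - d).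
  move=> Fk; elim/big_ind: _ => // [|y z yk zk]; first exact: spanN.1.
  by apply: lspanD.
rewrite chain_degE in mk.
suff term u v w : u ++ v ++ w = a ->
    sgn R ((deg m + rdeg u + rdeg v) * rdeg w + d * (deg m + rdeg a)) *:
      chain (mor f (vals w) (hval m) (vals u)) (vals v) \in CH_deg N (k - d).
  apply: (sum_in) => i; apply: (sum_in) => j; apply: term.
  by rewrite !cat_take_drop.
move=> uvw; apply: lspanZ; apply: lspan_sub.
have [h [E hd]] := ops_hval (mor_degree f) w m u.
exists h, v; split; last by rewrite /mor E.
by rewrite chain_degE hd -mk -uvw !rdeg_cat; lia.
Qed.

Lemma chainZ (L : ainf_bimodule A) c (x : gtotal (bimod_mod L)) s :
  chain (c *: x) s = c *: chain x s.
Proof.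
have cL := chain_linl (M := L) s.
by have := cL c x 0; rewrite (lin0 cL) !addr0.
Qed.

(** [hochschild_deconc] for a chain whose bimodule letter is a value of [f],
    hence of degree [d] more than the word [w m u]. *)
Lemma hochschild_mor (m : hel (bimod_mod M)) (u v w : seq hA) :
  hochschild_b N (chain (mor f (vals w) (hval m) (vals u)) (vals v)) =
  deconc3 (fun p q r =>
    sgn R ((rdeg w + deg m + rdeg u + d + rdeg p + rdeg q) * rdeg r) *:
    chain (muB (vals r) (mor f (vals w) (hval m) (vals u)) (vals p)) (vals q)) v
  + deconc3 (fun p q r => if nilp q then 0 else
      sgn R (rdeg w + deg m + rdeg u + d + rdeg p) *:
      chain (mor f (vals w) (hval m) (vals u))
        (vals p ++ mu (vals q) :: vals r)) v.
Proof.
have [h [E hd]] := ops_hval (mor_degree f) w m u.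
by rewrite /mor E hochschild_deconc hd.
Qed.

(** [induced_deconc] for a chain whose bimodule letter is a value of the
    bimodule operation, hence of degree one more than [w m u]. *)
Lemma induced_muB (m : hel (bimod_mod M)) (u v w : seq hA) :
  induced_map f (chain (muB (vals w) (hval m) (vals u)) (vals v)) =
  deconc3 (fun p q r =>
    sgn R ((rdeg w + deg m + rdeg u + 1 + rdeg p + rdeg q) * rdeg r
           + d * (rdeg w + deg m + rdeg u + 1 + rdeg v)) *:
    chain (mor f (vals r) (muB (vals w) (hval m) (vals u)) (vals p)) (vals q)) v.
Proof.
have [h [E hd]] := ops_hval (@bimod_degree _ _ M) w m u.
by rewrite /muB E induced_deconc hd.
Qed.

(** The letter [mu(v)] is, in this order, rotated in front of [m] and fed to
    [f]; left outside the arc of [f]; or fed to [f] behind [m]. *)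
Lemma induced_insert (m : hel (bimod_mod M)) (u v w : seq hA) : ~~ nilp v ->
  let e := d * (deg m + rdeg u + rdeg v + 1 + rdeg w) in
  induced_map f (chain (hval m) (vals u ++ mu (vals v) :: vals w)) =
  deconc3 (fun u1 u2 u3 =>
    sgn R ((deg m + rdeg u1 + rdeg u2) * (rdeg u3 + (rdeg v + 1) + rdeg w) + e) *:
    chain (mor f (vals u3 ++ mu (vals v) :: vals w) (hval m) (vals u1))
      (vals u2)) u
  + deconc (fun u1 u2 => deconc (fun w1 w2 =>
      sgn R ((deg m + rdeg u1 + (rdeg u2 + (rdeg v + 1) + rdeg w1)) * rdeg w2 + e) *:
      chain (mor f (vals w2) (hval m) (vals u1))
        (vals u2 ++ mu (vals v) :: vals w1)) w) u
  + deconc3 (fun w1 w2 w3 =>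
      sgn R ((deg m + (rdeg u + (rdeg v + 1) + rdeg w1) + rdeg w2) * rdeg w3 + e) *:
      chain (mor f (vals w3) (hval m) (vals u ++ mu (vals v) :: vals w1))
        (vals w2)) w.
Proof.
move=> /mu_hval[h [vh hd]] e.
have de : d * (deg m + rdeg (u ++ h :: w)) = e.
  by rewrite /e rdeg_cat rdeg_cons hd; lia.
have vals_ins s t : vals (s ++ h :: t) = vals s ++ hval h :: vals t.
  exact: vals_cat.
have rdeg_ins s t : rdeg (s ++ h :: t) = rdeg s + (rdeg v + 1) + rdeg t.
  by rewrite rdeg_cat rdeg_cons hd addrA.
rewrite vh -vals_ins induced_deconc deconc3_insert de.
congr (_ + _ + _).
- by apply: eq_deconc3 => u1 u2 u3 _; rewrite vals_ins rdeg_ins.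
- apply: eq_deconc => u1 u2 _; apply: eq_deconc => w1 w2 _.
  by rewrite vals_ins rdeg_ins.
- by apply: eq_deconc3 => w1 w2 w3 _; rewrite vals_ins rdeg_ins.
Qed.

End Operations.

(** * Comparison of the two composites *)

Section ChainMap.
Variables (R : comPzRingType) (A : ainf_algebra R).
Variables (M N : ainf_bimodule A) (d : int) (f : bimod_morphism M N d).
Local Notation hA := (hel (alg_mod A)).
Implicit Types (m : hel (bimod_mod M)) (u v w p q r y x a : seq hA).

(** The terms of the two composites, indexed by a cutting of [a] into five
    pieces, taken in the order in which they occur in [a].  The exponents of
    the signs are left as sums of the contributions of the two maps. *)
Definition mu_after_f m u p q r w : CH N :=
  sgn R ((deg m + rdeg u + rdeg p + rdeg q + rdeg r) * rdeg w
         + d * (deg m + rdeg u + rdeg p + rdeg q + rdeg r + rdeg w)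
         + (rdeg w + deg m + rdeg u + d + rdeg p + rdeg q) * rdeg r) *:
  chain (muB (vals r) (mor f (vals w) (hval m) (vals u)) (vals p)) (vals q).

Definition mu_beside_f m u p q r w : CH N :=
  if nilp q then 0 else
  sgn R ((deg m + rdeg u + rdeg p + rdeg q + rdeg r) * rdeg w
         + d * (deg m + rdeg u + rdeg p + rdeg q + rdeg r + rdeg w)
         + (rdeg w + deg m + rdeg u + d + rdeg p)) *:
  chain (mor f (vals w) (hval m) (vals u)) (vals p ++ mu (vals q) :: vals r).

Definition f_after_mu m u p q r w : CH N :=
  sgn R ((deg m + rdeg u + rdeg p + rdeg q + rdeg r) * rdeg w
         + ((rdeg w + deg m + rdeg u + 1 + rdeg p + rdeg q) * rdeg r
         + d * (rdeg w + deg m + rdeg u + 1 + (rdeg p + rdeg q + rdeg r)))) *: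
  chain (mor f (vals r) (muB (vals w) (hval m) (vals u)) (vals p)) (vals q).

(** Left and right refer to the side of [m] on which [f] receives the value of
    [mu]. *)
Definition f_of_mu_left m y q x1 x2 x3 : CH N :=
  if nilp x2 then 0 else
  sgn R ((deg m + rdeg y + rdeg q) * (rdeg x1 + (rdeg x2 + 1) + rdeg x3)
         + d * (deg m + (rdeg y + rdeg q + rdeg x1) + rdeg x2 + 1 + rdeg x3)
         + (deg m + (rdeg y + rdeg q + rdeg x1))) *:
  chain (mor f (vals x1 ++ mu (vals x2) :: vals x3) (hval m) (vals y)) (vals q).

Definition f_of_mu_right m y1 y2 y3 q x : CH N :=
  if nilp y2 then 0 else
  sgn R ((deg m + (rdeg y1 + (rdeg y2 + 1) + rdeg y3) + rdeg q) * rdeg x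
         + d * (deg m + rdeg y1 + rdeg y2 + 1 + (rdeg y3 + rdeg q + rdeg x))
         + (deg m + rdeg y1)) *:
  chain (mor f (vals x) (hval m) (vals y1 ++ mu (vals y2) :: vals y3)) (vals q).

(** The operation of [N] either absorbs the value of [f], or [mu] acts beside
    it. *)
Lemma hochschild_induced m a :
  hochschild_b N (induced_map f (chain (hval m) (vals a))) =
  deconc5 (mu_after_f m) a + deconc5 (mu_beside_f m) a.
Proof.
rewrite induced_deconc linear_deconc3; last exact: linearP.
rewrite -deconc3D; apply: eq_deconc3 => u v w uvw.
rewrite linearZ /= hochschild_mor scalerDr !scaler_deconc3.
congr (_ + _); apply: eq_deconc3 => p q r pqr; rewrite -uvw -pqr.
  by rewrite scaler_sgn; congr (_ *: _); rewrite !rdeg_cat; sgn_parity.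
rewrite /mu_beside_f; case: ifP => _; first by rewrite scaler0.
by rewrite scaler_sgn; congr (_ *: _); rewrite !rdeg_cat; sgn_parity.
Qed.

(** The value of the bimodule operation is always absorbed by [f]; the value of
    [mu] need not be, and when it is not, the term is literally one of those
    of [hochschild_induced]. *)
Lemma induced_hochschild m a :
  induced_map f (hochschild_b M (chain (hval m) (vals a))) =
  deconc5 (f_after_mu m) a
  + (deconc5 (f_of_mu_left m) a + deconc5 (mu_beside_f m) a
     + deconc5 (f_of_mu_right m) a).
Proof.
have fL : linear (induced_map f) by apply: linearP.
rewrite hochschild_deconc linearD /= !(linear_deconc3 _ _ fL).
congr (_ + _).
  apply: eq_deconc3 => u v w uvw; rewrite linearZ /= induced_muB scaler_deconc3.
  apply: eq_deconc3 => p q r pqr; rewrite scaler_sgn /f_after_mu; congr (_ *: _).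
  by rewrite -pqr !rdeg_cat; sgn_parity.
rewrite -(deconc5_left (f_of_mu_left m)) -(deconc5_right (f_of_mu_right m)).
rewrite -(deconc5_sides (mu_beside_f m)) -!deconc3D.
apply: eq_deconc3 => u v w uvw; have [v0|v0] := boolP (nilp v).
  rewrite linear0.
  have deconc0 (F : seq hA -> seq hA -> CH N) b :
      (forall s t, F s t = 0) -> deconc F b = 0.
    by move=> F0; rewrite /deconc big1.
  rewrite /deconc3 !deconc0 ?addr0 // => s t; rewrite deconc0 // => s' t';
    by rewrite /mu_beside_f /f_of_mu_left /f_of_mu_right v0.
rewrite linearZ /= induced_insert // !scalerDr !scaler_deconc3 scaler_deconc.
congr (_ + _ + _).
- apply: eq_deconc3 => u1 u2 u3 uE; rewrite scaler_sgn /f_of_mu_left (negbTE v0).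
  by congr (_ *: _); rewrite -uE !rdeg_cat; sgn_parity.
- apply: eq_deconc => u1 u2 uE; rewrite scaler_deconc.
  apply: eq_deconc => w1 w2 wE; rewrite scaler_sgn /mu_beside_f (negbTE v0).
  by congr (_ *: _); rewrite -uE -wE !rdeg_cat; sgn_parity.
- apply: eq_deconc3 => w1 w2 w3 wE; rewrite scaler_sgn /f_of_mu_right (negbTE v0).
  by congr (_ *: _); rewrite -wE !rdeg_cat; sgn_parity.
Qed.

(** For a fixed cutting [a = y q x], this is the morphism relation for [x m y]
    tensored with [q] and multiplied by the sign [e], which collects the sign
    for rotating [x] across [m y q] and the sign [d * deg] of the induced map. *)
Lemma rotated_morphism_relation m a :
  deconc5 (mu_after_f m) a =
  deconc5 (f_after_mu m) a + deconc5 (f_of_mu_left m) a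
  + deconc5 (f_of_mu_right m) a.
Proof.
rewrite -(deconc5_right (f_of_mu_left m)) -(deconc5_left (f_of_mu_right m)).
rewrite -(deconc5_sides (f_after_mu m)) -(deconc5_sides (mu_after_f m)).
rewrite -!deconc3D; apply: eq_deconc3 => y q x _.
pose e := rdeg x * (deg m + rdeg y + rdeg q)
  + d * (deg m + rdeg y + rdeg q + rdeg x).
pose phi (z : gtotal (bimod_mod N)) := sgn R e *: chain (M := N) z (vals q).
have phiL : linear phi.
  by move=> c z t; rewrite /phi chain_linl scalerDr !scalerA mulrC.
have phiZ k (z : gtotal (bimod_mod N)) :
    phi (sgn R k *: z) = sgn R (e + k) *: chain (M := N) z (vals q).
  by rewrite /phi chainZ scaler_sgn.
have phi0 : phi 0 = 0 := lin0 phiL.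
rewrite !(exchange_deconc _ y x).
have := congr1 phi (morphism_deconc f m x y).
rewrite !(linD phiL) !(linear_deconc3 _ _ phiL) !(linear_deconc _ _ phiL) => rel.
transitivity (deconc (fun x1 x2 => phi (deconc (fun y1 y2 => sgn R (d * rdeg x1) *:
  muB (vals x1) (mor f (vals x2) (hval m) (vals y1)) (vals y2)) y)) x).
  apply: eq_deconc => r w xE; rewrite (linear_deconc _ _ phiL).
  apply: eq_deconc => u p yE; rewrite phiZ; congr (_ *: _).
  by rewrite /e -xE -yE !rdeg_cat; sgn_parity.
rewrite {}rel [X in _ = X + _]addrC; congr (_ + _ + _).
- apply: eq_deconc3 => x1 x2 x3 xE; rewrite /f_of_mu_left.
  case: ifP => // _; rewrite phiZ; congr (_ *: _).
  by rewrite /e -xE !rdeg_cat; sgn_parity.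
- apply: eq_deconc => r w xE; rewrite (linear_deconc _ _ phiL).
  apply: eq_deconc => u p yE; rewrite phiZ; congr (_ *: _).
  by rewrite /e -xE -yE !rdeg_cat; sgn_parity.
- apply: eq_deconc3 => y1 y2 y3 yE; rewrite /f_of_mu_right.
  case: ifP => // _; rewrite phiZ; congr (_ *: _).
  by rewrite /e -yE !rdeg_cat; sgn_parity.
Qed.

End ChainMap.

Theorem theorem2p8 (R : comPzRingType) (A : ainf_algebra R)
    (M N : ainf_bimodule A) (d : int) (f : bimod_morphism M N d) :
  (forall (k : int) (x : CH M),
     x \in CH_deg M k -> induced_map f x \in CH_deg N (k - d)) /\
  (forall x : CH M,
     hochschild_b N (induced_map f x) = induced_map f (hochschild_b M x)).
Proof.
split; first exact: induced_map_degree.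
apply: CH_ext => [||m a].
- by apply: lin_comp; apply: linearP.
- by apply: lin_comp; apply: linearP.
rewrite hochschild_induced induced_hochschild rotated_morphism_relation.
by rewrite -!addrA [in RHS](addrC (deconc5 (mu_beside_f f m) a)).
Qed.
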